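(* Let $\gamma\in\mathbb{R}_{>0}$ and suppose: 1) there is a sequence $(P_t)_{t\in\mathbb{N}_0}\subset\mathbb{S}_+^n$ such that $(\exists\varepsilon\in\mathbb{R}_{>0})(\forall t\in\mathbb{N}_0)\ P_{t+1}-\gamma^2I_n\preceq-\varepsilon I_n$, and $(\forall t\in\mathbb{N}_0)\ P_t=\mathcal{R}_{\gamma,t}(P_{t+1})$; and 2) there exist $\underline{c},\overline{c}\in\mathbb{R}_{>0}$ such that for all $t\in\mathbb{N}_0$: (a) $\underline{c}I_{(m+n)d}\preceq\tilde R_{0|t}'\tilde R_{0|t}\preceq\overline{c}I_{(m+n)d}$, (b) $\underline{c}I_n\preceq\tilde B_{0|t}\tilde R_{0|t}^{-1}\tilde B_{0|t}'\preceq\overline{c}I_n$, and (c) $\underline{c}I_n\preceq\tilde Q_{0|t}\preceq\overline{c}I_n$. Further, let $\beta\in\mathbb{R}_{>0}$, and define $$\underline{\alpha}:=(\gamma^{-2}-(\gamma+\beta)^{-2})\,\underline{\kappa},\qquad \underline{\kappa}:=\inf_{t\in\mathbb{N}_0}\lambda_{\min}(\tilde Q_{0|t})>0,$$ $$\overline{\delta}:=\sqrt{n}\,\log\left(\sup_{t\in\mathbb{N}_0}\frac{\lambda_{\max}(\tilde Q_{0|t}+\tilde A_{0|t}'(\tilde B_{0|t}\tilde R_{0|t}^{-1}\tilde B_{0|t}')^{-1}\tilde A_{0|t})}{\lambda_{\min}(\tilde Q_{0|t})}\right)<+\infty,$$ $$\overline{\rho}:=\sup_{t\in\mathbb{N}_0}\frac{1}{1+\tilde\omega_t}<1,\qquad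 \tilde\omega_t:=\frac{\lambda_{\min}(\tilde Q_{0|t}+\tilde Q_{0|t}\tilde A_{0|t}^{-1}\tilde B_{0|t}\tilde R_{0|t}^{-1}\tilde B_{0|t}'(\tilde A_{0|t}')^{-1}\tilde Q_{0|t})}{\lambda_{\max}(\tilde Q_{0|t}+\tilde A_{0|t}'(\tilde B_{0|t}\tilde R_{0|t}^{-1}\tilde B_{0|t}')^{-1}\tilde A_{0|t})}.$$ Let $T\in\mathbb{N}$ be any number with $$T>\underline{T}:=\log\Big(\log\big((\underline{\alpha}+1)^{1/\overline{\delta}}\big)\Big)\Big/\log(\overline{\rho}),$$ let $(X_{t+1})_{t\in\mathbb{N}_0}$ be constructed from the model data, $\gamma$ and $T$ by $$X_{t+1}:=\tilde{\mathcal{R}}_{\gamma,0|t+1}\circ\cdots\circ\tilde{\mathcal{R}}_{\gamma,T-1|t+1}(\tilde X_{t+1}),\qquad \tilde X_{t+1}:=\tilde Q_{T|t+1}+\tilde A_{T|t+1}'(\tilde B_{T|t+1}\tilde R_{T|t+1}^{-1}\tilde B_{T|t+1}')^{-1}\tilde A_{T|t+1},$$ and let the control input of the system be given by the state feedback policy $u_t=-K_{\gamma+\beta,t}(X_{t+1})\,x_t$, $t\in\mathbb{N}_0$. Then $J_{\gamma+\beta}(u,w)\le0$ for all $w\in\ell_2$.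
   Context: Notation. $\mathbb{N}_0=\{0\}\cup\mathbb{N}$. $X'$ is the transpose of $X$. $\mathbb{S}^n$, $\mathbb{S}_+^n$, $\mathbb{S}_{++}^n$ are the real symmetric, symmetric positive semidefinite, and symmetric positive definite $n\times n$ matrices. $Y\preceq Z$ means $Z-Y\in\mathbb{S}_+^n$; $Y\prec Z$ means $Z-Y\in\mathbb{S}_{++}^n$. $Z^{1/2}$ is the positive semidefinite square root of $Z\in\mathbb{S}_+^n$. $0_{p,q}$ is the $p\times q$ zero matrix. $\mathrm{diag}(\cdot)$ is block diagonal. $\ell_2$ is the set of sequences $w=(w_t)_{t\in\mathbb{N}_0}$ with $\|w\|_2^2:=\sum_t w_t'w_t<+\infty$. System. $x_{t+1}=A_tx_t+B_tu_t+w_t$, $t\in\mathbb{N}_0$, $x_0=0\in\mathbb{R}^n$, $u_t\in\mathbb{R}^m$, $w_t\in\mathbb{R}^n$, with performance output $z_t=\begin{bmatrix}Q_t^{1/2}x_t\\ R_t^{1/2}u_t\end{bmatrix}$, where $A_t\in\mathbb{R}^{n\times n}$, $B_t\in\mathbb{R}^{n\times m}$, $Q_t\in\mathbb{S}_+^n$, $R_t\in\mathbb{S}_{++}^m$. For $\alpha>0$, $J_\alpha(u,w):=\|z\|_2^2-\alpha^2\|w\|_2^2=\sum_{t\in\mathbb{N}_0}(z_t'z_t-\alpha^2w_t'w_t)$. Standing assumptions. (i) $A_t,B_t,Q_t,R_t$ and the inverses $A_t^{-1},R_t^{-1}$ are uniformly bounded over $t\in\mathbb{N}_0$ (in particular $A_t$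 is non-singular). (ii) With $\Phi_{t,t}:=I_n$ and $\Phi_{s,t}:=A_{s-1}\cdots A_t$ for $s>t$, there exist $d\in\mathbb{N}$ and $c>0$ such that for all $t\in\mathbb{N}_0$: $\sum_{s=t}^{t+d-1}\Phi_{s,t}'Q_s\Phi_{s,t}\succeq cI_n$ and $\sum_{s=t}^{t+d-1}\Phi_{t+d,s+1}B_sB_s'\Phi_{t+d,s+1}'\succeq cI_n$. Such a $d$ is fixed throughout. One-step Riccati operator. For $\gamma>0$ and $P\in\mathbb{S}^n$, $\mathcal{R}_{\gamma,t}(P):=Q_t+A_t'PA_t-L_t(P)'(M_{\gamma,t}(P))^{-1}L_t(P)$, where $L_t(P):=\begin{bmatrix}B_t&I_n\end{bmatrix}'PA_t$ and $M_{\gamma,t}(P):=\begin{bmatrix}R_t+B_t'PB_t&B_t'P\\ PB_t&P-\gamma^2I_n\end{bmatrix}$. Feedback gain. For $\alpha>0$ and $X\in\mathbb{S}_{++}^n$ with $X\prec\alpha^2I_n$, $K_{\alpha,t}(X):=(\nabla_{\alpha,t}(X))^{-1}B_t'(X^{-1}-\alpha^{-2}I_n)^{-1}A_t$, with $\nabla_{\alpha,t}(X):=R_t+B_t'(X^{-1}-\alpha^{-2}I_n)^{-1}B_t$. Lifted data. For $t,k\in\mathbb{N}_0$ let $\Lambda_{k|t}:=I_{n(d+1)}-\begin{bmatrix}0_{n,nd}&0_{n,n}\\ \mathrm{diag}(A_{t+dk},\dots,A_{t+d(k+1)-1})&0_{nd,n}\end{bmatrix}$, $\Xi_{k|t}:=\begin{bmatrix}0_{n,md}\\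 \mathrm{diag}(B_{t+dk},\dots,B_{t+d(k+1)-1})\end{bmatrix}$, $\Gamma_{k|t}:=\begin{bmatrix}\mathrm{diag}(Q_{t+dk}^{1/2},\dots,Q_{t+d(k+1)-1}^{1/2})&0_{nd,n}\end{bmatrix}$, $R_{k|t}:=\mathrm{diag}(R_{t+dk},\dots,R_{t+d(k+1)-1})$, and $A_{k|t}:=\begin{bmatrix}0_{n,nd}&I_n\end{bmatrix}\Lambda_{k|t}^{-1}\begin{bmatrix}I_n\\ 0_{nd,n}\end{bmatrix}$, $B_{k|t}:=\begin{bmatrix}0_{n,nd}&I_n\end{bmatrix}\Lambda_{k|t}^{-1}\Xi_{k|t}$, $F_{k|t}:=\begin{bmatrix}0_{n,nd}&I_n\end{bmatrix}\Lambda_{k|t}^{-1}\begin{bmatrix}0_{n,nd}\\ I_{nd}\end{bmatrix}$, $C_{k|t}:=\Gamma_{k|t}\Lambda_{k|t}^{-1}\begin{bmatrix}I_n\\ 0_{nd,n}\end{bmatrix}$, $D_{k|t}:=\Gamma_{k|t}\Lambda_{k|t}^{-1}\Xi_{k|t}$, $E_{k|t}:=\Gamma_{k|t}\Lambda_{k|t}^{-1}\begin{bmatrix}0_{n,nd}\\ I_{nd}\end{bmatrix}$. Transformed lifted data (depending on $\gamma$). $\tilde B_{k|t}:=\begin{bmatrix}B_{k|t}&F_{k|t}\end{bmatrix}$, $\tilde R_{k|t}:=\begin{bmatrix}R_{k|t}+D_{k|t}'D_{k|t}&D_{k|t}'E_{k|t}\\ E_{k|t}'D_{k|t}&E_{k|t}'E_{k|t}-\gamma^2I_{nd}\end{bmatrix}$,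 and, when $\tilde R_{k|t}$ is non-singular, $\tilde Q_{k|t}:=C_{k|t}'C_{k|t}-C_{k|t}'\begin{bmatrix}D_{k|t}&E_{k|t}\end{bmatrix}\tilde R_{k|t}^{-1}\begin{bmatrix}D_{k|t}'\\ E_{k|t}'\end{bmatrix}C_{k|t}$ and $\tilde A_{k|t}:=A_{k|t}-\begin{bmatrix}B_{k|t}&F_{k|t}\end{bmatrix}\tilde R_{k|t}^{-1}\begin{bmatrix}D_{k|t}'\\ E_{k|t}'\end{bmatrix}C_{k|t}$ (non-singular whenever $\tilde R_{k|t}$ is). Lifted Riccati operator. $\tilde{\mathcal{R}}_{\gamma,k|t}(X):=\tilde Q_{k|t}+\tilde A_{k|t}'\big(X-X\tilde B_{k|t}(\tilde R_{k|t}+\tilde B_{k|t}'X\tilde B_{k|t})^{-1}\tilde B_{k|t}'X\big)\tilde A_{k|t}$. *)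

(* Defs.v *)
From HB Require Import structures.
From mathcomp Require Import all_boot all_order all_algebra.
From mathcomp Require Import boolp classical_sets reals ereal.
From mathcomp Require Import topology normedtype sequences exp.

Set Implicit Arguments.
Unset Strict Implicit.
Unset Printing Implicit Defensive.

Import Order.TTheory GRing.Theory Num.Theory.
Local Open Scope classical_set_scope.
Local Open Scope ring_scope.

Definition symmx (R : realType) (n : nat) (Z : 'M[R]_n) : Prop := Z^T = Z.

Definition psdmx (R : realType) (n : nat) (Z : 'M[R]_n) : Prop :=
  symmx Z /\ forall v : 'cV[R]_n, 0 <= (v^T *m Z *m v) 0 0.

Definition pdmx (R : realType) (n : nat) (Z : 'M[R]_n) : Prop :=
  symmx Z /\ forall v : 'cV[R]_n, v != 0 -> 0 < (v^T *m Z *m v) 0 0.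

Definition loewner_le (R : realType) (n : nat) (Y Z : 'M[R]_n) : Prop :=
  psdmx (Z - Y).

Definition loewner_lt (R : realType) (n : nat) (Y Z : 'M[R]_n) : Prop :=
  pdmx (Z - Y).

(* For [Z] in S_+^n there is exactly one [S] as below; the default value 0 is
   only used outside S_+^n. *)
Definition sqrtmx (R : realType) (n : nat) (Z : 'M[R]_n) : 'M[R]_n :=
  xget 0 [set S : 'M[R]_n | psdmx S /\ S *m S = Z].

(* These are only applied to symmetric matrices of positive size, which have a
   nonempty finite set of real eigenvalues. *)
Definition lambda_min (R : realType) (n : nat) (Z : 'M[R]_n) : R :=
  inf [set a : R | eigenvalue Z a].

Definition lambda_max (R : realType) (n : nat) (Z : 'M[R]_n) : R :=
  sup [set a : R | eigenvalue Z a].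

(* Bounded in the entrywise max norm, i.e. in any matrix norm. *)
Definition unif_bounded (R : realType) (p q : nat) (M : nat -> 'M[R]_(p, q)) :
    Prop :=
  exists C : R, forall t (i : 'I_p) (j : 'I_q), `|M t i j| <= C.

(* ||w||_2^2 in the extended reals: a series with nonnegative terms, equal to
   +oo exactly when w is not square summable. *)
Definition l2norm_sq (R : realType) (p : nat) (w : nat -> 'cV[R]_p) : \bar R :=
  (\sum_(0 <= t <oo) (((w t)^T *m w t) 0 0)%:E)%E.

Definition ell2 (R : realType) (p : nat) (w : nat -> 'cV[R]_p) : Prop :=
  (l2norm_sq w < +oo)%E.

Record ltv_system (R : realType) (n m : nat) := LtvSystem {
  sysA : nat -> 'M[R]_n;
  sysB : nat -> 'M[R]_(n, m);
  sysQ : nat -> 'M[R]_n;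
  sysR : nat -> 'M[R]_m }.

Fixpoint state (R : realType) (n m : nat) (S : ltv_system R n m)
    (u : nat -> 'cV[R]_m) (w : nat -> 'cV[R]_n) (t : nat) : 'cV[R]_n :=
  if t is s.+1 then
    sysA S s *m state S u w s + sysB S s *m u s + w s
  else 0.

Definition perf_output (R : realType) (n m : nat) (S : ltv_system R n m)
    (u : nat -> 'cV[R]_m) (w : nat -> 'cV[R]_n) (t : nat) : 'cV[R]_(n + m) :=
  col_mx (sqrtmx (sysQ S t) *m state S u w t) (sqrtmx (sysR S t) *m u t).

(* Never of the form oo - oo when [w] is in ell2; the value is +oo if the
   performance output is not square summable. *)
Definition perf_J (R : realType) (n m : nat) (S : ltv_system R n m) (alpha : R)
    (u : nat -> 'cV[R]_m) (w : nat -> 'cV[R]_n) : \bar R :=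
  (l2norm_sq (perf_output S u w) - (alpha ^+ 2)%:E * l2norm_sq w)%E.

(* [transition_add A t k] is A_{t+k-1} ... A_t. *)
Fixpoint transition_add (R : realType) (n : nat) (A : nat -> 'M[R]_n)
    (t k : nat) : 'M[R]_n :=
  if k is j.+1 then A (t + j)%N *m transition_add A t j else 1%:M.

(* Phi_{s,t}; only used for t <= s. *)
Definition transition (R : realType) (n : nat) (A : nat -> 'M[R]_n)
    (s t : nat) : 'M[R]_n :=
  transition_add A t (s - t).

Record standing_assumptions (R : realType) (n m : nat) (S : ltv_system R n m)
    (d : nat) : Prop := StandingAssumptions {
  sa_Qpsd : forall t, psdmx (sysQ S t);
  sa_Rpd : forall t, pdmx (sysR S t);
  sa_Abnd : unif_bounded (sysA S);
  sa_Bbnd : unif_bounded (sysB S);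
  sa_Qbnd : unif_bounded (sysQ S);
  sa_Rbnd : unif_bounded (sysR S);
  sa_Aunit : forall t, sysA S t \in unitmx;
  sa_AVbnd : unif_bounded (fun t => invmx (sysA S t));
  sa_RVbnd : unif_bounded (fun t => invmx (sysR S t));
  sa_gram : exists2 c : R, 0 < c & forall t,
    loewner_le c%:M
      (\sum_(t <= s < t + d)
         (transition (sysA S) s t)^T *m sysQ S s *m transition (sysA S) s t) /\
    loewner_le c%:M
      (\sum_(t <= s < t + d)
         transition (sysA S) (t + d) s.+1 *m sysB S s *m (sysB S s)^T
           *m (transition (sysA S) (t + d) s.+1)^T) }.

Definition ricL (R : realType) (n m : nat) (S : ltv_system R n m) (t : nat)
    (P : 'M[R]_n) : 'M[R]_(m + n, n) :=
  (row_mx (sysB S t) 1%:M)^T *m P *m sysA S t.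

Definition ricM (R : realType) (n m : nat) (S : ltv_system R n m) (gamma : R)
    (t : nat) (P : 'M[R]_n) : 'M[R]_(m + n) :=
  block_mx (sysR S t + (sysB S t)^T *m P *m sysB S t) ((sysB S t)^T *m P)
           (P *m sysB S t)                            (P - (gamma ^+ 2)%:M).

Definition riccati (R : realType) (n m : nat) (S : ltv_system R n m)
    (gamma : R) (t : nat) (P : 'M[R]_n) : 'M[R]_n :=
  sysQ S t + (sysA S t)^T *m P *m sysA S t
    - (ricL S t P)^T *m invmx (ricM S gamma t P) *m ricL S t P.

Definition gain_nabla (R : realType) (n m : nat) (S : ltv_system R n m)
    (alpha : R) (t : nat) (X : 'M[R]_n) : 'M[R]_m :=
  sysR S t
    + (sysB S t)^T *m invmx (invmx X - (alpha ^- 2)%:M) *m sysB S t.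

Definition gain (R : realType) (n m : nat) (S : ltv_system R n m)
    (alpha : R) (t : nat) (X : 'M[R]_n) : 'M[R]_(m, n) :=
  invmx (gain_nabla S alpha t X)
    *m (sysB S t)^T *m invmx (invmx X - (alpha ^- 2)%:M) *m sysA S t.

(* The size p * d of a stack of d blocks of size p, in the form used by the
   [\mxblock] operator. *)
Notation stack d p := (\sum_(i < d) p)%N.

(* [\mxdiag] only takes square blocks. *)
Definition blkdiag (R : realType) (p q d : nat) (M : nat -> 'M[R]_(p, q)) :
    'M[R]_(stack d p, stack d q) :=
  \mxblock_(i < d, j < d) (if i == j then M i else 0).

(* Rows of the lifted matrices below are split as n + nd, while columns are
   split as nd + n; the casts identify both with n(d+1). *)
Definition lift_Lambda (R : realType) (n m : nat) (S : ltv_system R n m)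
    (d k t : nat) : 'M[R]_(n + stack d n) :=
  1%:M - castmx (erefl, addnC (stack d n) n)
    (block_mx (0 : 'M[R]_(n, stack d n)) (0 : 'M[R]_(n, n))
              (blkdiag d (fun i => sysA S (t + d * k + i)%N))
              (0 : 'M[R]_(stack d n, n))).

Definition lift_Xi (R : realType) (n m : nat) (S : ltv_system R n m)
    (d k t : nat) : 'M[R]_(n + stack d n, stack d m) :=
  col_mx 0 (blkdiag d (fun i => sysB S (t + d * k + i)%N)).

Definition lift_Gamma (R : realType) (n m : nat) (S : ltv_system R n m)
    (d k t : nat) : 'M[R]_(stack d n, n + stack d n) :=
  castmx (erefl, addnC (stack d n) n)
    (row_mx (blkdiag d (fun i => sqrtmx (sysQ S (t + d * k + i)%N)))
            (0 : 'M[R]_(stack d n, n))).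

Definition lift_R (R : realType) (n m : nat) (S : ltv_system R n m)
    (d k t : nat) : 'M[R]_(stack d m) :=
  blkdiag d (fun i => sysR S (t + d * k + i)%N).

Definition lift_last (R : realType) (n d : nat) : 'M[R]_(n, n + stack d n) :=
  castmx (erefl, addnC (stack d n) n)
    (row_mx (0 : 'M[R]_(n, stack d n)) (1%:M : 'M[R]_n)).

Definition lift_first (R : realType) (n d : nat) : 'M[R]_(n + stack d n, n) :=
  col_mx 1%:M 0.

Definition lift_tail (R : realType) (n d : nat) :
    'M[R]_(n + stack d n, stack d n) :=
  col_mx 0 1%:M.

Definition lift_A (R : realType) (n m : nat) (S : ltv_system R n m)
    (d k t : nat) : 'M[R]_n :=
  lift_last R n d *m invmx (lift_Lambda S d k t) *m lift_first R n d.

Definition lift_B (R : realType) (n m : nat) (S : ltv_system R n m)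
    (d k t : nat) : 'M[R]_(n, stack d m) :=
  lift_last R n d *m invmx (lift_Lambda S d k t) *m lift_Xi S d k t.

Definition lift_F (R : realType) (n m : nat) (S : ltv_system R n m)
    (d k t : nat) : 'M[R]_(n, stack d n) :=
  lift_last R n d *m invmx (lift_Lambda S d k t) *m lift_tail R n d.

Definition lift_C (R : realType) (n m : nat) (S : ltv_system R n m)
    (d k t : nat) : 'M[R]_(stack d n, n) :=
  lift_Gamma S d k t *m invmx (lift_Lambda S d k t) *m lift_first R n d.

Definition lift_D (R : realType) (n m : nat) (S : ltv_system R n m)
    (d k t : nat) : 'M[R]_(stack d n, stack d m) :=
  lift_Gamma S d k t *m invmx (lift_Lambda S d k t) *m lift_Xi S d k t.

Definition lift_E (R : realType) (n m : nat) (S : ltv_system R n m)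
    (d k t : nat) : 'M[R]_(stack d n) :=
  lift_Gamma S d k t *m invmx (lift_Lambda S d k t) *m lift_tail R n d.

Definition tilde_B (R : realType) (n m : nat) (S : ltv_system R n m)
    (d k t : nat) : 'M[R]_(n, stack d m + stack d n) :=
  row_mx (lift_B S d k t) (lift_F S d k t).

Definition lift_DE (R : realType) (n m : nat) (S : ltv_system R n m)
    (d k t : nat) : 'M[R]_(stack d n, stack d m + stack d n) :=
  row_mx (lift_D S d k t) (lift_E S d k t).

Definition tilde_R (R : realType) (n m : nat) (S : ltv_system R n m)
    (gamma : R) (d k t : nat) : 'M[R]_(stack d m + stack d n) :=
  let D := lift_D S d k t in
  let E := lift_E S d k t in
  block_mx (lift_R S d k t + D^T *m D) (D^T *m E)
           (E^T *m D)                  (E^T *m E - (gamma ^+ 2)%:M).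

Definition tilde_Q (R : realType) (n m : nat) (S : ltv_system R n m)
    (gamma : R) (d k t : nat) : 'M[R]_n :=
  let C := lift_C S d k t in
  C^T *m C
    - C^T *m lift_DE S d k t *m invmx (tilde_R S gamma d k t)
        *m (lift_DE S d k t)^T *m C.

Definition tilde_A (R : realType) (n m : nat) (S : ltv_system R n m)
    (gamma : R) (d k t : nat) : 'M[R]_n :=
  lift_A S d k t
    - tilde_B S d k t *m invmx (tilde_R S gamma d k t)
        *m (lift_DE S d k t)^T *m lift_C S d k t.

Definition tilde_W (R : realType) (n m : nat) (S : ltv_system R n m)
    (gamma : R) (d k t : nat) : 'M[R]_n :=
  tilde_B S d k t *m invmx (tilde_R S gamma d k t) *m (tilde_B S d k t)^T.

Definition lifted_riccati (R : realType) (n m : nat) (S : ltv_system R n m)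
    (gamma : R) (d k t : nat) (X : 'M[R]_n) : 'M[R]_n :=
  let A := tilde_A S gamma d k t in
  let B := tilde_B S d k t in
  tilde_Q S gamma d k t
    + A^T *m (X - X *m B *m invmx (tilde_R S gamma d k t + B^T *m X *m B)
                    *m B^T *m X) *m A.

Definition tilde_X (R : realType) (n m : nat) (S : ltv_system R n m)
    (gamma : R) (d k t : nat) : 'M[R]_n :=
  tilde_Q S gamma d k t
    + (tilde_A S gamma d k t)^T *m invmx (tilde_W S gamma d k t)
        *m tilde_A S gamma d k t.

(* The composition over k = 0, ..., T-1 (k = T-1 innermost) applied to the
   terminal value, all with base time t. *)
Definition preview_X (R : realType) (n m : nat) (S : ltv_system R n m)
    (gamma : R) (d T t : nat) : 'M[R]_n :=
  foldr (fun k X => lifted_riccati S gamma d k t X)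
        (tilde_X S gamma d T t) (iota 0 T).

Definition kappa_low (R : realType) (n m : nat) (S : ltv_system R n m)
    (gamma : R) (d : nat) : R :=
  inf [set lambda_min (tilde_Q S gamma d 0 t) | t in [set: nat]].

Definition alpha_low (R : realType) (n m : nat) (S : ltv_system R n m)
    (gamma beta : R) (d : nat) : R :=
  (gamma ^- 2 - (gamma + beta) ^- 2) * kappa_low S gamma d.

Definition delta_ratio (R : realType) (n m : nat) (S : ltv_system R n m)
    (gamma : R) (d t : nat) : R :=
  lambda_max (tilde_X S gamma d 0 t) / lambda_min (tilde_Q S gamma d 0 t).

Definition delta_up (R : realType) (n m : nat) (S : ltv_system R n m)
    (gamma : R) (d : nat) : R :=
  Num.sqrt n%:R * ln (sup [set delta_ratio S gamma d t | t in [set: nat]]).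

Definition omega_tilde (R : realType) (n m : nat) (S : ltv_system R n m)
    (gamma : R) (d t : nat) : R :=
  let Q := tilde_Q S gamma d 0 t in
  let A := tilde_A S gamma d 0 t in
  lambda_min (Q + Q *m invmx A *m tilde_W S gamma d 0 t *m invmx A^T *m Q)
    / lambda_max (tilde_X S gamma d 0 t).

Definition rho_factor (R : realType) (n m : nat) (S : ltv_system R n m)
    (gamma : R) (d t : nat) : R :=
  1 / (1 + omega_tilde S gamma d t).

Definition rho_up (R : realType) (n m : nat) (S : ltv_system R n m)
    (gamma : R) (d : nat) : R :=
  sup [set rho_factor S gamma d t | t in [set: nat]].

Definition T_low (R : realType) (n m : nat) (S : ltv_system R n m)
    (gamma beta : R) (d : nat) : R :=
  ln (ln ((alpha_low S gamma beta d + 1) `^ (1 / delta_up S gamma d)))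
    / ln (rho_up S gamma d).

(* Main.v *)
(* The stationary trajectories of the game over d steps show that the Riccati
   solution satisfies P_t = f_t(P_{t+d}), where f_t, the lifted Riccati map,
   equals X |-> Q + A' (X^-1 + W)^-1 A with the transformed lifted data; f_t is
   monotone and bounded by its value X~_t at infinity. The contraction is
   measured in the order (Thompson's metric), which is dominated by the
   Riemannian metric of the informal rate: if P <= X <= mu P, then
   f_t(P) <= f_t(X) <= mu^rho f_t(P) with rho = 1 / (1 + omega_t). Starting
   from P <= X~ <= mu0 P, T iterations give P <= X <= mu0^(rho^T) P, and the
   bound on T makes the last factor at most alpha + 1. This yields
   X^-1 - (gamma + beta)^-2 >= P^-1 - gamma^-2 > 0, so the gain computed from X
   is dissipative at level gamma + beta with the storage function x' P_t x. *)

(* The game Hessian [tilde_R] is indefinite, so the inputs cannot be eliminated by a single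
   minimisation. Stationarity is instead a linear equation, read off from a bilinear identity
   between a stationary and an arbitrary trajectory; solving it only takes the invertibility of
   [tilde_R] and of 1 + W P. As the P_t are at first merely semidefinite, the d-step identity is
   proved in the form P_s = Q + A' P (1 + W P)^-1 A, with P = P_{s+d} and the transformed lifted
   data; it yields P_s >= Q > 0, and only then is P inverted.

   The constant alpha comes from the inverses: if X <= (1 + alpha) P and P >= kappa, then P^-1 -
   X^-1 <= alpha P^-1 <= alpha / kappa = gamma^-2 - (gamma + beta)^-2. Hence the one-step game with
   terminal weight X at level gamma + beta costs no more than the one with P at level gamma, whose
   value is P_t; and P <= X turns the terminal weight back into the storage function of the next
   step. *)
Require Import Defs.
From HB Require Import structures.
From mathcomp Require Import all_boot all_order all_algebra.
From mathcomp Require Import boolp classical_sets reals ereal.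
From mathcomp Require Import topology normedtype sequences exp.
From mathcomp Require Import ring lra.

Set Implicit Arguments.
Unset Strict Implicit.
Unset Printing Implicit Defensive.

Import Order.TTheory GRing.Theory Num.Theory.
Local Open Scope classical_set_scope.
Local Open Scope ring_scope.

(** * Quadratic forms and the Loewner order *)

Section dot.
Variable R : realType.
Implicit Types (p q : nat).

Definition dot p (u v : 'cV[R]_p) : R := (u^T *m v) 0 0.

Lemma dotE p (u v : 'cV[R]_p) : dot u v = \sum_i u i 0 * v i 0.
Proof. by rewrite /dot mxE; apply: eq_bigr => i _; rewrite mxE. Qed.

Lemma dotC p (u v : 'cV[R]_p) : dot u v = dot v u.
Proof. by rewrite !dotE; apply: eq_bigr => i _; rewrite mulrC. Qed.

Lemma dotDr p (u v w : 'cV[R]_p) : dot u (v + w) = dot u v + dot u w.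
Proof. by rewrite /dot mulmxDr mxE. Qed.

Lemma dotDl p (u v w : 'cV[R]_p) : dot (u + v) w = dot u w + dot v w.
Proof. by rewrite !(dotC _ w) dotDr. Qed.

Lemma dotNr p (u v : 'cV[R]_p) : dot u (- v) = - dot u v.
Proof. by rewrite /dot mulmxN mxE. Qed.

Lemma dotNl p (u v : 'cV[R]_p) : dot (- u) v = - dot u v.
Proof. by rewrite !(dotC _ v) dotNr. Qed.

Lemma dotZr p a (u v : 'cV[R]_p) : dot u (a *: v) = a * dot u v.
Proof. by rewrite /dot -scalemxAr mxE. Qed.

Lemma dotZl p a (u v : 'cV[R]_p) : dot (a *: u) v = a * dot u v.
Proof. by rewrite !(dotC _ v) dotZr. Qed.

Lemma dot0r p (u : 'cV[R]_p) : dot u 0 = 0.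
Proof. by rewrite /dot mulmx0 mxE. Qed.

Lemma dot0l p (u : 'cV[R]_p) : dot 0 u = 0.
Proof. by rewrite dotC dot0r. Qed.

Lemma dot_mull p q (M : 'M[R]_(p, q)) u v : dot (M *m u) v = dot u (M^T *m v).
Proof. by rewrite /dot trmx_mul mulmxA. Qed.

Lemma dot_mulr p q (M : 'M[R]_(p, q)) u v : dot u (M *m v) = dot (M^T *m u) v.
Proof. by rewrite dot_mull trmxK. Qed.

Lemma dot_sym p (M : 'M[R]_p) u v : M^T = M -> dot u (M *m v) = dot v (M *m u).
Proof. by move=> sM; rewrite dot_mulr sM dotC. Qed.

Lemma dot_ge0 p (u : 'cV[R]_p) : 0 <= dot u u.
Proof. by rewrite dotE sumr_ge0 // => i _; rewrite -expr2 sqr_ge0. Qed.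

Lemma dot_eq0 p (u : 'cV[R]_p) : (dot u u == 0) = (u == 0).
Proof.
apply/idP/eqP => [|->]; last by rewrite dot0r.
rewrite dotE psumr_eq0 => [/allP u0|i _]; last by rewrite -expr2 sqr_ge0.
apply/matrixP => i j; rewrite (ord1 j) mxE; apply/eqP.
by move: (u0 i); rewrite mem_index_enum mulf_eq0 orbb; apply.
Qed.

Lemma dot_gt0 p (u : 'cV[R]_p) : (0 < dot u u) = (u != 0).
Proof. by rewrite lt0r dot_eq0 dot_ge0 andbT. Qed.

Lemma dot_injr p (u v : 'cV[R]_p) : (forall y, dot u y = dot v y) -> u = v.
Proof.
move=> uv; apply/eqP; rewrite -subr_eq0 -dot_eq0.
by rewrite dotDl dotNl uv subrr.
Qed.

Lemma dot_col_mx p q (a c : 'cV[R]_p) (b e : 'cV[R]_q) :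
  dot (col_mx a b) (col_mx c e) = dot a c + dot b e.
Proof. by rewrite /dot tr_col_mx mul_row_col mxE. Qed.

Lemma entry_sqr_le_dot p (u : 'cV[R]_p) i : u i 0 ^+ 2 <= dot u u.
Proof.
rewrite dotE (bigD1 i) //= -expr2 lerDl sumr_ge0 // => j _.
by rewrite -expr2 sqr_ge0.
Qed.

Lemma mulmx_eqP p q (M N : 'M[R]_(p, q)) :
  (forall v : 'cV_q, M *m v = N *m v) -> M = N.
Proof.
move=> MN; apply/matrixP => i j.
by have /matrixP/(_ i 0) := MN (delta_mx j 0); rewrite -!colE !mxE.
Qed.

Lemma unitmx_ker p (M : 'M[R]_p) :
  (forall v : 'cV_p, M *m v = 0 -> v = 0) -> M \in unitmx.
Proof.
move=> kerM; rewrite -unitmx_tr -row_free_unit -kermx_eq0; apply/rowV0P => v.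
move=> /sub_kermxP vM; apply: trmx_inj; rewrite trmx0; apply: kerM.
by rewrite -[M]trmxK -trmx_mul vM trmx0.
Qed.

Lemma unitmx_inj p (M : 'M[R]_p) (v : 'cV_p) :
  M \in unitmx -> M *m v = 0 -> v = 0.
Proof. by move=> uM Mv; rewrite -(mulKmx uM v) Mv mulmx0. Qed.

Lemma symmx_inv p (M : 'M[R]_p) : M^T = M -> (invmx M)^T = invmx M.
Proof. by move=> sM; rewrite trmx_inv sM. Qed.

End dot.

Section loewner.
Variable R : realType.
Implicit Types (p q : nat).

(* The Loewner order without the symmetry of Z - Y. *)
Definition qle p (Y Z : 'M[R]_p) : Prop :=
  forall v, dot v (Y *m v) <= dot v (Z *m v).

Lemma qle_addr p (Y Z : 'M[R]_p) :
  (forall v, 0 <= dot v (Z *m v)) -> qle Y (Y + Z).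
Proof. by move=> Z_ge0 v; rewrite mulmxDl dotDr lerDl. Qed.

Lemma psdmxP p (Z : 'M[R]_p) :
  psdmx Z <-> Z^T = Z /\ forall v, 0 <= dot v (Z *m v).
Proof.
by split=> -[sZ Z_ge0]; split=> // v; have := Z_ge0 v; rewrite /dot mulmxA.
Qed.

Lemma pdmxP p (Z : 'M[R]_p) :
  pdmx Z <-> Z^T = Z /\ forall v, v != 0 -> 0 < dot v (Z *m v).
Proof.
by split=> -[sZ Z_gt0]; split=> // v /Z_gt0; rewrite /dot mulmxA.
Qed.

Lemma pd_sym p (Z : 'M[R]_p) : pdmx Z -> Z^T = Z.
Proof. by case. Qed.

Lemma pd_gt0 p (Z : 'M[R]_p) v : pdmx Z -> v != 0 -> 0 < dot v (Z *m v).
Proof. by move=> /pdmxP[_]; apply. Qed.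

Lemma pd_psd p (Z : 'M[R]_p) : pdmx Z -> psdmx Z.
Proof.
move=> /pdmxP[sZ Z_gt0]; apply/psdmxP; split=> // v.
by have [->|/Z_gt0/ltW//] := eqVneq v 0; rewrite dot0l.
Qed.

Lemma psd_ge0 p (Z : 'M[R]_p) v : psdmx Z -> 0 <= dot v (Z *m v).
Proof. by move=> /psdmxP[_]; apply. Qed.

Lemma loewner_leP p (Y Z : 'M[R]_p) : loewner_le Y Z -> qle Y Z.
Proof.
move=> /psdmxP[_ YZ] v; rewrite -subr_ge0 -dotNr -dotDr -mulNmx -mulmxDl.
exact: YZ.
Qed.

Lemma loewner_le_sym_scalar p a (Z : 'M[R]_p) : loewner_le a%:M Z -> Z^T = Z.
Proof.
by move=> [+ _]; rewrite /symmx linearB /= tr_scalar_mx => /addIr.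
Qed.

Lemma pd_unit p (Z : 'M[R]_p) : pdmx Z -> Z \in unitmx.
Proof.
move=> pZ; apply: unitmx_ker => v Zv; apply/eqP/negPn/negP => /(pd_gt0 pZ).
by rewrite Zv dot0r ltxx.
Qed.

Lemma pd_inv p (Z : 'M[R]_p) : pdmx Z -> pdmx (invmx Z).
Proof.
move=> pZ; have uZ := pd_unit pZ; apply/pdmxP.
split=> [|v v0]; first by rewrite symmx_inv // pd_sym.
rewrite -{1}(mulKVmx uZ v) dotC; apply: pd_gt0 => //.
by apply: contra_neq v0 => Zv; rewrite -(mulKVmx uZ v) Zv mulmx0.
Qed.

Lemma pd_scalar p (a : R) : 0 < a -> pdmx (a%:M : 'M[R]_p).
Proof.
move=> a0; apply/pdmxP; rewrite tr_scalar_mx; split=> // v v0.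
by rewrite mul_scalar_mx dotZr mulr_gt0 // dot_gt0.
Qed.

Lemma qle_pd p (Y Z : 'M[R]_p) : Z^T = Z -> pdmx Y -> qle Y Z -> pdmx Z.
Proof.
move=> sZ pY YZ; apply/pdmxP; split=> // v v0.
exact: lt_le_trans (pd_gt0 pY v0) (YZ v).
Qed.

Lemma pd_addl p (Y Z : 'M[R]_p) : pdmx Y -> psdmx Z -> pdmx (Y + Z).
Proof.
move=> pY pZ; apply: (qle_pd _ pY); first by rewrite linearD /= pd_sym ?pZ.1.
by move=> v; rewrite mulmxDl dotDr lerDl psd_ge0.
Qed.

Lemma psd_congr p q (Z : 'M[R]_p) (M : 'M[R]_(p, q)) :
  psdmx Z -> psdmx (M^T *m Z *m M).
Proof.
move=> pZ; apply/psdmxP; rewrite !trmx_mul trmxK pZ.1 mulmxA; split=> // v.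
by rewrite -2!mulmxA -dot_mull psd_ge0.
Qed.

Lemma pd_congr p (Z M : 'M[R]_p) :
  pdmx Z -> M \in unitmx -> pdmx (M^T *m Z *m M).
Proof.
move=> pZ uM; apply/pdmxP; rewrite (psd_congr M (pd_psd pZ)).1; split=> // v v0.
rewrite -2!mulmxA -dot_mull pd_gt0 //.
by apply: contra_neq v0 => /(unitmx_inj uM).
Qed.

(** Expansion of (y - z)' Z (y - z) >= 0 at z = Z^-1 v. This variational form of the inverse yields
    its antitonicity, coercivity and the worst-case disturbance bound without square roots. *)
Lemma pd_fenchel p (Z : 'M[R]_p) y v : pdmx Z ->
  2 * dot y v - dot y (Z *m y) <= dot v (invmx Z *m v).
Proof.
move=> pZ; have uZ := pd_unit pZ; set z := invmx Z *m v.
have -> : v = Z *m z by rewrite mulKVmx.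
have := psd_ge0 (y - z) (pd_psd pZ).
rewrite mulmxBr !(dotDl, dotDr, dotNl, dotNr) (dot_sym z y (pd_sym pZ)).
by rewrite [dot _ z]dotC; lra.
Qed.

Lemma qle_inv p (Y Z : 'M[R]_p) :
  pdmx Y -> pdmx Z -> qle Y Z -> qle (invmx Z) (invmx Y).
Proof.
move=> pY pZ YZ v; have := pd_fenchel (invmx Z *m v) v pY.
have := YZ (invmx Z *m v); rewrite mulKVmx ?pd_unit // (dotC _ v); lra.
Qed.

Lemma pd_inv_lt p (Y Z : 'M[R]_p) :
  pdmx Y -> pdmx Z -> pdmx (Z - Y) -> pdmx (invmx Y - invmx Z).
Proof.
move=> pY pZ pZY; apply/pdmxP; split=> [|v v0].
  by rewrite linearB /= !symmx_inv // pd_sym.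
have z0 : invmx Z *m v != 0.
  by apply: contra_neq v0 => /unitmx_inj; rewrite unitmx_inv pd_unit //; apply.
have := pd_fenchel (invmx Z *m v) v pY; have := pd_gt0 pZY z0.
rewrite !mulmxBl !(dotDr, dotNr) mulKVmx ?pd_unit // !(dotC _ v); lra.
Qed.

Lemma form_bound p (Z : 'M[R]_p) :
  exists2 C : R, 0 < C & forall v, `|dot v (Z *m v)| <= C * dot v v.
Proof.
pose C := \sum_i \sum_j `|Z i j|.
have C0 : 0 <= C by do 2!(apply: sumr_ge0 => ? _).
(* The added 1 makes the bound positive even for Z = 0, so that it can be inverted later. *)
exists (1 + C) => [|v]; first by rewrite ltr_pwDl.
apply: (@le_trans _ _ (C * dot v v)); last first.
  by rewrite ler_wpM2r ?dot_ge0 // lerDr.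
rewrite dotE mulr_suml; apply: le_trans (ler_norm_sum _ _ _) _.
apply: ler_sum => i _; rewrite mxE mulr_sumr mulr_suml.
apply: le_trans (ler_norm_sum _ _ _) _; apply: ler_sum => j _.
rewrite mulrCA normrM; apply: ler_wpM2l; first exact: normr_ge0.
rewrite ler_norml; have := entry_sqr_le_dot v i; have := entry_sqr_le_dot v j.
by have := sqr_ge0 (v i 0 + v j 0); have := sqr_ge0 (v i 0 - v j 0); nra.
Qed.

Lemma pd_coercive p (Z : 'M[R]_p) : pdmx Z ->
  exists2 e : R, 0 < e & forall v, e * dot v v <= dot v (Z *m v).
Proof.
move=> pZ; have [C C0 CP] := form_bound (invmx Z).
exists C^-1 => [|v]; first by rewrite invr_gt0.
(* With C bounding Z^-1, the choice y = C v gives 2C |v|^2 - C^2 v'Zv <= C |v|^2, hence the constant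
   1 / C. *)
have := pd_fenchel (C *: v) v pZ; have := CP v; rewrite ler_norml => /andP[_].
rewrite -scalemxAr !(dotZl, dotZr) => vCv Hf.
by rewrite ler_pdivrMl // -(ler_pM2l C0); lra.
Qed.

(** Such a v minimises the form, so the gradient Z v must vanish: a descent step of length 1 / C
    along it would make the form negative, C being an upper bound of Z. *)
Lemma psd_eq0 p (Z : 'M[R]_p) v : psdmx Z -> dot v (Z *m v) = 0 -> Z *m v = 0.
Proof.
move=> pZ vZv; have [C C0 CP] := form_bound Z; set y := Z *m v.
have := CP y; rewrite ler_norml => /andP[_ yZy].
have := psd_ge0 (v - C^-1 *: y) pZ.
rewrite mulmxBr -scalemxAr !(dotDl, dotDr, dotNl, dotNr, dotZl, dotZr) vZv.
rewrite (dot_sym v y pZ.1) -/y => H.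
apply/eqP; rewrite -dot_eq0 eq_le dot_ge0 andbT.
have Ci0 : 0 < C^-1 by rewrite invr_gt0.
have : C^-1 * (C^-1 * dot y (Z *m y)) <= C^-1 * dot y y.
  by rewrite ler_pM2l // ler_pdivrMl.
by nra.
Qed.

Lemma psd_unit_pd p (Z : 'M[R]_p) : psdmx Z -> Z \in unitmx -> pdmx Z.
Proof.
move=> pZ uZ; apply/pdmxP; split=> [|v v0]; first exact: pZ.1.
rewrite lt0r psd_ge0 // andbT; apply: contra_neq v0 => /(psd_eq0 pZ).
exact: unitmx_inj.
Qed.

(** mu is the largest a with a U <= Z. Were Z - mu U invertible, it would be coercive and mu could
    be raised; so it is singular, and a kernel vector is the eigenvector. U = 1 gives ordinary
    eigenvalues, U = A' W^-1 A the contraction rate. *)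
Lemma generalized_eigenvalue_min p (Z U : 'M[R]_p) :
  (0 < p)%N -> Z^T = Z -> pdmx U ->
  exists mu, exists2 e : 'cV_p, e != 0 & Z *m e = mu *: (U *m e) /\
    forall v, mu * dot v (U *m v) <= dot v (Z *m v).
Proof.
case: p Z U => // p Z U _ sZ pU.
pose E := [set a : R | forall v, a * dot v (U *m v) <= dot v (Z *m v)].
have [C C0 CZ] := form_bound Z; have [c c0 cU] := pd_coercive pU.
have supE : has_sup E.
  split.
    exists (- (C / c)) => v; rewrite -subr_ge0.
    have := CZ v; rewrite ler_norml => /andP[+ _].
    have : C / c * (c * dot v v) <= C / c * dot v (U *m v).
      by rewrite ler_wpM2l // divr_ge0 // ltW.
    by rewrite mulrA divfK ?gt_eqF //; lra.
  pose e : 'cV[R]_p.+1 := delta_mx 0 0.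
  have e0 : e != 0.
    apply/eqP => /matrixP/(_ 0 0); rewrite !mxE !eqxx => /eqP.
    by rewrite oner_eq0.
  exists (dot e (Z *m e) / dot e (U *m e)) => a /(_ e) ae.
  by rewrite ler_pdivlMr // pd_gt0.
pose mu := sup E.
have muE : E mu.
  move=> v; have [->|v0] := eqVneq v 0; first by rewrite !dot0l mulr0.
  rewrite -ler_pdivlMr ?pd_gt0 //; apply: ge_sup; first exact: supE.1.
  by move=> a /(_ v); rewrite ler_pdivlMr ?pd_gt0.
pose K := Z - mu *: U.
have KE v : dot v (K *m v) = dot v (Z *m v) - mu * dot v (U *m v).
  by rewrite mulmxBl dotDr dotNr -scalemxAl dotZr.
have pK : psdmx K.
  apply/psdmxP; rewrite linearB linearZ /= sZ pd_sym //.
  by split=> // v; rewrite KE subr_ge0.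
have : K \notin unitmx.
  apply/negP => /(psd_unit_pd pK)/pd_coercive[k k0 kK].
  have [D D0 UD] := form_bound U.
  have : E (mu + k / D).
    move=> v; have := kK v; rewrite KE.
    have := UD v; rewrite ler_norml => /andP[_ UvD].
    have : k / D * dot v (U *m v) <= k * dot v v.
      by rewrite -mulrA ler_pM2l // ler_pdivrMl.
    by lra.
  move=> /(ub_le_sup supE.2); rewrite -/mu gerDl leNgt.
  by rewrite divr_gt0.
rewrite -unitmx_tr -row_free_unit -kermx_eq0 => /rowV0Pn[e + e0].
move=> /sub_kermxP eK; exists mu; exists e^T; first by rewrite trmx_eq0.
split=> //; apply/eqP; rewrite -subr_eq0 scalemxAl -mulmxBl -/K.
by rewrite -[K]trmxK -trmx_mul eK trmx0.
Qed.

Lemma eigenvalue_symP p (Z : 'M[R]_p) a : Z^T = Z ->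
  reflect (exists2 e : 'cV_p, e != 0 & Z *m e = a *: e) (eigenvalue Z a).
Proof.
move=> sZ; apply: (iffP eigenvalueP) => -[e].
  move=> eZ e0; exists e^T; rewrite ?trmx_eq0 //.
  by rewrite -{1}sZ -trmx_mul eZ linearZ.
move=> e0 Ze; exists e^T; rewrite ?trmx_eq0 //.
by rewrite -{1}sZ -trmx_mul Ze linearZ.
Qed.

(** Later arguments see the spectrum only through this Rayleigh bound and a vector attaining it. *)
Lemma lambda_minP p (Z : 'M[R]_p) : (0 < p)%N -> Z^T = Z ->
  (forall v, lambda_min Z * dot v v <= dot v (Z *m v)) /\
  exists2 e, e != 0 & dot e (Z *m e) = lambda_min Z * dot e e.
Proof.
move=> p0 sZ.
have [mu [e e0]] := generalized_eigenvalue_min p0 sZ (pd_scalar p ltr01).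
rewrite mul1mx => -[Ze muZ].
suff -> : lambda_min Z = mu.
  split=> [v|]; last by exists e => //; rewrite Ze dotZr.
  by rewrite -{2}[v]mul1mx.
have lbE : lbound [set a | eigenvalue Z a] mu.
  move=> a /= /(eigenvalue_symP _ sZ)[f f0 Zf].
  by have := muZ f; rewrite Zf dotZr mul1mx ler_pM2r ?dot_gt0.
have muE : [set a | eigenvalue Z a] mu.
  by apply/(eigenvalue_symP _ sZ); exists e.
apply/eqP; rewrite eq_le; apply/andP; split.
  by apply: ge_inf => //; exists mu.
by apply: lb_le_inf => //; exists mu.
Qed.

Lemma lambda_maxP p (Z : 'M[R]_p) : (0 < p)%N -> Z^T = Z ->
  (forall v, dot v (Z *m v) <= lambda_max Z * dot v v) /\
  exists2 e, e != 0 & dot e (Z *m e) = lambda_max Z * dot e e.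
Proof.
move=> p0 sZ.
have sZN : (- Z)^T = - Z by rewrite linearN /= sZ.
have eigN (a : R) : eigenvalue (- Z) a = eigenvalue Z (- a).
  apply/(eigenvalue_symP _ sZN)/(eigenvalue_symP _ sZ) => -[e e0 Ze];
    exists e => //.
    by rewrite -[Z]opprK mulNmx Ze scaleNr.
  by rewrite mulNmx Ze scaleNr opprK.
have -> : lambda_max Z = - lambda_min (- Z).
  rewrite /lambda_min /inf opprK; congr sup; apply/seteqP; split=> a /=.
    by move=> ea; exists (- a); rewrite ?opprK //= eigN opprK.
  by move=> [b /=]; rewrite eigN => eb <-.
have [ZN [e e0 Ze]] := lambda_minP p0 sZN; split=> [v|].
  by have := ZN v; rewrite mulNmx dotNr; lra.
by exists e => //; move: Ze; rewrite mulNmx dotNr; lra.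
Qed.

Lemma le_lambda_min p (Z : 'M[R]_p) a : (0 < p)%N -> Z^T = Z ->
  (forall v, a * dot v v <= dot v (Z *m v)) -> a <= lambda_min Z.
Proof.
move=> p0 sZ aZ; have [_ [e e0 Ze]] := lambda_minP p0 sZ.
by have := aZ e; rewrite Ze ler_pM2r ?dot_gt0.
Qed.

Lemma lambda_max_le p (Z : 'M[R]_p) a : (0 < p)%N -> Z^T = Z ->
  (forall v, dot v (Z *m v) <= a * dot v v) -> lambda_max Z <= a.
Proof.
move=> p0 sZ aZ; have [_ [e e0 Ze]] := lambda_maxP p0 sZ.
by have := aZ e; rewrite Ze ler_pM2r ?dot_gt0.
Qed.

Lemma psd_top_eigenvector p (Z : 'M[R]_p) : psdmx Z -> Z != 0 ->
  exists lam, exists2 e, dot e e = 1 & [/\ 0 < lam, Z *m e = lam *: e &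
    forall v, dot v (Z *m v) <= lam * dot v v].
Proof.
case: p Z => [|p] Z pZ Z0.
  by case/negP: Z0; apply/eqP/matrixP => -[].
have sZN : (- Z)^T = - Z by rewrite linearN /= pZ.1.
have [mu [e e0]] :=
  generalized_eigenvalue_min (ltn0Sn p) sZN (pd_scalar _ ltr01).
rewrite mul1mx mulNmx => -[Ze muZ].
have Zle v : dot v (Z *m v) <= - mu * dot v v.
  by have := muZ v; rewrite mulNmx mul1mx dotNr mulNr lerNr.
have mu0 : 0 < - mu.
  rewrite ltNge; apply/negP => mu0; case/negP: Z0; apply/eqP/mulmx_eqP => v.
  rewrite mul0mx; apply: psd_eq0 => //; apply/eqP.
  rewrite eq_le psd_ge0 // andbT.
  by apply: le_trans (Zle v) _; rewrite mulr_le0_ge0 ?dot_ge0.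
exists (- mu); exists ((Num.sqrt (dot e e))^-1 *: e).
  rewrite dotZl dotZr mulrA -expr2 exprVn sqr_sqrtr ?dot_ge0 //.
  by rewrite mulVf // dot_eq0.
split=> //; rewrite -scalemxAr; have -> : Z *m e = (- mu) *: e.
  by rewrite scaleNr -Ze opprK.
by rewrite !scalerA mulrC.
Qed.

(* Induction on the rank, splitting off a top eigenvector. *)
Lemma psd_sqrt_exists p (Z : 'M[R]_p) : psdmx Z ->
  exists S : 'M[R]_p, psdmx S /\ S *m S = Z.
Proof.
have [r] := ubnP (\rank Z); elim: r Z => // r IHr Z rZ pZ.
have [->|Z0] := eqVneq Z 0.
  exists 0; rewrite mul0mx; split=> //; apply/psdmxP; rewrite trmx0.
  by split=> // v; rewrite mul0mx dot0r.
have [lam [e e1 [lam0 Ze Zle]]] := psd_top_eigenvector pZ Z0.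
have eeT v : e *m e^T *m v = dot e v *: e.
  rewrite -mulmxA [e^T *m v]mx11_scalar mul_mx_scalar; congr (_ *: _).
pose Z1 := Z - lam *: (e *m e^T).
have sZ1 : Z1^T = Z1 by rewrite linearB linearZ /= trmx_mul trmxK pZ.1.
have Z1v v : Z1 *m v = Z *m v - (lam * dot e v) *: e.
  by rewrite mulmxBl -scalemxAl eeT scalerA.
have Z1e : Z1 *m e = 0 by rewrite Z1v Ze e1 mulr1 subrr.
have pZ1 : psdmx Z1.
  apply/psdmxP; split=> // v; have := psd_ge0 (v - dot e v *: e) pZ.
  rewrite Z1v mulmxBr -scalemxAr Ze !(dotDl, dotDr, dotNl, dotNr, dotZl, dotZr).
  rewrite e1 (dotC v e) [dot e (Z *m v)](dot_sym _ _ pZ.1) Ze dotZr (dotC v e).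
  by lra.
have eTZ : e^T *m Z = lam *: e^T by rewrite -{1}pZ.1 -trmx_mul Ze linearZ.
(* The rank drops because e lies in the row space of Z, while everything in the row space of Z1 is
   orthogonal to e. *)
have rZ1 : (\rank Z1 < r)%N.
  suff /rank_ltmx/leq_trans : (Z1 < Z)%MS by apply; rewrite -ltnS.
  have Z1E : Z1 = (1%:M - e *m e^T) *m Z.
    by rewrite mulmxBl mul1mx -mulmxA eTZ -scalemxAr.
  rewrite ltmxE {1}Z1E submxMl /=; apply/negP => ZZ1.
  have /submxP[y eyZ1] : (e^T <= Z1)%MS.
    apply: submx_trans ZZ1; apply/submxP; exists (lam^-1 *: e^T).
    by rewrite -scalemxAl eTZ scalerA mulVf ?scale1r // gt_eqF.
  have := e1; rewrite /dot eyZ1 -mulmxA Z1e mulmx0 mxE => /eqP.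
  by rewrite eq_sym oner_eq0.
have [S1 [pS1 S1S1]] := IHr _ rZ1 pZ1.
have S1e : S1 *m e = 0.
  apply/eqP; rewrite -dot_eq0 dot_mull pS1.1 mulmxA S1S1 Z1e dot0r.
  by rewrite eqxx.
exists (S1 + Num.sqrt lam *: (e *m e^T)); split.
  apply/psdmxP; rewrite linearD linearZ /= trmx_mul trmxK pS1.1; split=> // v.
  rewrite mulmxDl -scalemxAl eeT !(dotDr, dotZr) (dotC v e) -expr2.
  by rewrite addr_ge0 ?psd_ge0 // mulr_ge0 ?sqrtr_ge0 ?sqr_ge0.
apply/mulmx_eqP => v; rewrite -mulmxA !mulmxDl -!scalemxAl !eeT.
rewrite dotDr !dotZr e1 mulmxDr mulmxA S1S1 -!scalemxAr S1e !scaler0 addr0.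
rewrite (dot_sym e v pS1.1) S1e dot0r add0r mulr1 Z1v.
by rewrite !scalerA mulrA -expr2 sqr_sqrtr ?subrK // ltW.
Qed.

Lemma sqrtmxP p (Z : 'M[R]_p) : psdmx Z ->
  (sqrtmx Z)^T = sqrtmx Z /\ sqrtmx Z *m sqrtmx Z = Z.
Proof.
move=> /psd_sqrt_exists[S0 HS0]; rewrite /sqrtmx.
by case: xgetP => [S _ [[]]|/(_ S0)].
Qed.

Lemma dot_sqrtmx p (Z : 'M[R]_p) u v : psdmx Z ->
  dot (sqrtmx Z *m u) (sqrtmx Z *m v) = dot u (Z *m v).
Proof. by move=> /sqrtmxP[sS SS]; rewrite dot_mull sS mulmxA SS. Qed.

End loewner.

(** * Trajectories of the lifted system *)

Section stack.
Variable R : realType.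
Implicit Types (p q d : nat).

(** Blocks are indexed by natural numbers so that shifted sequences such as x_{i+1} can be stacked
    directly; only the values below d count. *)
Definition stk p d (f : nat -> 'cV[R]_p) : 'cV[R]_(stack d p) :=
  \mxcol_(i < d) f i.

Lemma stk_exists p d (v : 'cV[R]_(stack d p)) : exists f, v = stk d f.
Proof.
exists (fun i => if insub i is Some j then submxcol v j else 0).
by rewrite -[LHS]submxcolK; apply/eq_mxcol => i; rewrite valK.
Qed.

Lemma stk_inj p d (f g : nat -> 'cV[R]_p) i :
  stk d f = stk d g -> (i < d)%N -> f i = g i.
Proof.
rewrite /stk => fg id.
by rewrite -(mxcolK (fun i : 'I_d => f i) (Ordinal id)) fg mxcolK.
Qed.

Lemma eq_stk p d (f g : nat -> 'cV[R]_p) :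
  (forall i, (i < d)%N -> f i = g i) -> stk d f = stk d g.
Proof. by move=> fg; apply/eq_mxcol => i; apply: fg. Qed.

Lemma stkD p d (f g : nat -> 'cV[R]_p) :
  stk d f + stk d g = stk d (fun i => f i + g i).
Proof. by rewrite /stk mxcolD. Qed.

Lemma stk0 p d : stk d (fun=> 0) = 0 :> 'cV[R]_(stack d p).
Proof. exact: mxcol0. Qed.

Lemma blkdiag_stk p q d (M : nat -> 'M[R]_(p, q)) f :
  blkdiag d M *m stk d f = stk d (fun i => M i *m f i).
Proof.
rewrite /blkdiag /stk mul_mxblock_mxrow; apply/eq_mxcol => i.
rewrite (bigD1 i) //= eqxx big1 ?addr0 // => j ji.
by rewrite eq_sym (negPf ji) mul0mx.
Qed.

Lemma dot_stk p d (f g : nat -> 'cV[R]_p) :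
  dot (stk d f) (stk d g) = \sum_(i < d) dot (f i) (g i).
Proof. by rewrite /dot tr_mxcol mul_mxrow_mxcol summxE. Qed.

Lemma RankE d p (i : 'I_d) (r : 'I_p) :
  tagnat.Rank (p_ := fun=> p) i r = (i * p + r)%N :> nat.
Proof.
rewrite tagnat.RankEsum; congr (_ + _)%N.
rewrite -(big_ord_widen d (fun=> p) (ltnW (ltn_ord i))).
by rewrite sum_nat_const card_ord.
Qed.

Lemma stack_indexP d p (k : 'I_(stack d p)) :
  exists i : 'I_d, exists r : 'I_p, k = (i * p + r)%N :> nat.
Proof.
exists (tagnat.sig1 k), (tagnat.sig2 k : 'I_p).
by rewrite -RankE tagnat.sig2K.
Qed.

Lemma stk_entry p d (f : nat -> 'cV[R]_p) (k : 'I_(stack d p)) i (r : 'I_p) :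
  (i < d)%N -> k = (i * p + r)%N :> nat -> stk d f k 0 = f i r 0.
Proof.
move=> id kE; have -> : k = tagnat.Rank (p_ := fun=> p) (Ordinal id) r.
  by apply: ord_inj; rewrite RankE.
have /matrixP/(_ r 0) := mxcolK (fun i : 'I_d => f i) (Ordinal id).
by rewrite mxE.
Qed.

(* Both sides stack x 0, ..., x d, grouped as 1 + d and as d + 1 blocks. *)
Lemma castmx_shift_stk p d (x : nat -> 'cV[R]_p) :
  castmx (esym (addnC (stack d p) p), erefl)
    (col_mx (x 0) (stk d (fun i => x i.+1))) = col_mx (stk d x) (x d).
Proof.
(* Either grouping puts coordinate r of block i at position i p + r, for every i <= d; the casts
   preserve positions. *)
have entry (k : 'I_(p + stack d p)) i (r : 'I_p) : (i <= d)%N ->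
    k = (i * p + r)%N :> nat ->
    col_mx (x 0) (stk d (fun i => x i.+1)) k 0 = x i r 0.
  move=> id kE; case: (splitP k) => k' kk'; last first.
    have -> : k = rshift _ k' by apply: ord_inj.
    rewrite col_mxEd; case: i => [|i] in id kE *.
      by have := ltn_ord r; rewrite -[r : nat]add0n -kE kk' ltnNge leq_addr.
    apply: stk_entry => //.
    by apply/eqP; rewrite -(eqn_add2l p) -kk' kE mulSn addnA.
  have -> : k = lshift _ k' by apply: ord_inj.
  rewrite col_mxEu; case: i => [|i] in id kE *.
    by congr (x 0 _ 0); apply: ord_inj; rewrite -kk' kE.
  have := ltn_ord k'.
  by rewrite -kk' kE mulSn -addnA ltnNge leq_addr.
apply/matrixP => j l; rewrite (ord1 l) castmxE /= cast_ord_id.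
case: (splitP j) => [k jk|k jk].
  have -> : j = lshift _ k by apply: val_inj.
  have [i [r kE]] := stack_indexP k.
  rewrite col_mxEu (stk_entry _ _ kE) //.
  by apply: entry; rewrite /= ?kE // ltnW.
have -> : j = rshift _ k by apply: val_inj.
rewrite col_mxEd; apply: entry => //=.
by rewrite sum_nat_const card_ord.
Qed.

Lemma castmx_cols_mul p q q' (e : q = q') (M : 'M[R]_(p, q)) (v : 'cV[R]_q') :
  castmx (erefl, e) M *m v = M *m castmx (esym e, erefl) v.
Proof. by case: q' / e v => v; rewrite !castmx_id. Qed.

End stack.

Section lifted_system.
Variables (R : realType) (n m : nat) (S : ltv_system R n m) (d k t : nat).

Local Notation A i := (sysA S (t + d * k + i)).
Local Notation B i := (sysB S (t + d * k + i)).
Local Notation Q i := (sysQ S (t + d * k + i)).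

Fixpoint traj (x : 'cV[R]_n) (u : nat -> 'cV[R]_m) (w : nat -> 'cV[R]_n) i :=
  if i is j.+1 then A j *m traj x u w j + B j *m u j + w j else x.

(** [lift_Lambda] maps a state sequence to its initial state and its residuals x_{i+1} - A_i x_i.
    Inverting it therefore means solving the state recursion. *)
Lemma lift_Lambda_stk (x : nat -> 'cV[R]_n) :
  lift_Lambda S d k t *m col_mx (x 0) (stk d (fun i => x i.+1)) =
  col_mx (x 0) (stk d (fun i => x i.+1 - A i *m x i)).
Proof.
rewrite /lift_Lambda mulmxBl mul1mx castmx_cols_mul castmx_shift_stk.
rewrite mul_block_col !mul0mx !addr0 blkdiag_stk opp_col_mx add_col_mx.
by rewrite oppr0 addr0 /stk mxcolB.
Qed.

Lemma lift_Lambda_unit : lift_Lambda S d k t \in unitmx.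
Proof.
apply: unitmx_ker => v; rewrite -[v]vsubmxK.
have [f ->] := stk_exists (dsubmx v).
pose x i := if i is j.+1 then f j else usubmx v.
rewrite (_ : col_mx _ _ = col_mx (x 0) (stk d (fun i => x i.+1))) //.
rewrite lift_Lambda_stk -[in RHS](@col_mx0 _ n (stack d n) 1).
move=> /eq_col_mx[x0 xS].
have {}x0 i : (i <= d)%N -> x i = 0.
  elim: i => // i IHi id; move: xS; rewrite -stk0 => /stk_inj/(_ id)/eqP.
  by rewrite (IHi (ltnW id)) mulmx0 subr0 => /eqP.
rewrite x0 // (_ : stk _ _ = 0) ?col_mx0 // -[RHS]stk0.
by apply: eq_stk => i id; rewrite x0.
Qed.

Section trajectory.
Variables (x : 'cV[R]_n) (u : nat -> 'cV[R]_m) (w : nat -> 'cV[R]_n).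
Let xi := traj x u w.
Let v := col_mx (stk d u) (stk d w).

(** The vector on the left holds the initial state and the forcing B u + w. Through this identity
    the lifted matrices describe the end point and the weighted states of a trajectory. *)
Lemma lift_Lambda_traj :
  invmx (lift_Lambda S d k t) *m
    (lift_first R n d *m x + lift_Xi S d k t *m stk d u +
     lift_tail R n d *m stk d w) =
  col_mx (xi 0) (stk d (fun i => xi i.+1)).
Proof.
apply: (can_inj (mulKmx lift_Lambda_unit)).
rewrite mulKVmx ?lift_Lambda_unit // lift_Lambda_stk.
rewrite /lift_first /lift_Xi /lift_tail !mul_col_mx !mul0mx !mul1mx.
rewrite !add_col_mx !addr0 add0r blkdiag_stk stkD; congr col_mx.
by apply: eq_stk => i _ /=; rewrite -[X in X - _]addrA addrAC subrr add0r.
Qed.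

Lemma lift_state :
  lift_A S d k t *m x + tilde_B S d k t *m v = xi d.
Proof.
rewrite /tilde_B mul_row_col addrA -!mulmxA -!mulmxDr lift_Lambda_traj.
rewrite /lift_last castmx_cols_mul castmx_shift_stk mul_row_col.
by rewrite mul0mx mul1mx add0r.
Qed.

Lemma lift_output :
  lift_C S d k t *m x + lift_DE S d k t *m v =
  stk d (fun i => sqrtmx (Q i) *m xi i).
Proof.
rewrite /lift_DE mul_row_col addrA -!mulmxA -!mulmxDr lift_Lambda_traj.
rewrite /lift_Gamma castmx_cols_mul castmx_shift_stk mul_row_col.
by rewrite mul0mx addr0 blkdiag_stk.
Qed.

End trajectory.

Lemma lift_input_exists (v : 'cV[R]_(stack d m + stack d n)) :
  exists u w, v = col_mx (stk d u) (stk d w).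
Proof.
have [u uE] := stk_exists (usubmx v); have [w wE] := stk_exists (dsubmx v).
by exists u, w; rewrite -uE -wE vsubmxK.
Qed.

(** [tilde_R] is the polarised game cost of inputs applied from the state 0. The bilinear form is
    kept because stationarity is tested against variations (u', w'). *)
Lemma tilde_R_form gamma u w u' w' :
  let v := col_mx (stk d u) (stk d w) in
  let v' := col_mx (stk d u') (stk d w') in
  dot v (tilde_R S gamma d k t *m v') =
  dot (lift_DE S d k t *m v) (lift_DE S d k t *m v') +
  \sum_(i < d) (dot (u i) (sysR S (t + d * k + i) *m u' i) -
                gamma ^+ 2 * dot (w i) (w' i)).
Proof.
move=> v v'.
have -> : tilde_R S gamma d k t = (lift_DE S d k t)^T *m lift_DE S d k t +
    block_mx (lift_R S d k t) 0 0 (- (gamma ^+ 2)%:M).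
  rewrite /tilde_R /lift_DE tr_row_mx mul_col_row add_block_mx !addr0.
  by rewrite [_ + lift_R _ _ _ _]addrC.
rewrite mulmxDl dotDr -mulmxA -dot_mull.
congr (_ + _); rewrite mul_block_col !mul0mx addr0 add0r dot_col_mx.
rewrite blkdiag_stk mulNmx mul_scalar_mx dotNr dotZr !dot_stk mulr_sumr -sumrN.
by rewrite -big_split.
Qed.

End lifted_system.

(** * The Riccati map X |-> Q + A' (X^-1 + W)^-1 A *)

Section riccati_map.
Variables (R : realType) (n : nat).
Implicit Types (Q W A X P : 'M[R]_n).

Definition pd_riccati Q W A X : 'M[R]_n :=
  Q + A^T *m invmx (invmx X + W) *m A.

Lemma sum_congr_qf Q Z A v :
  dot v ((Q + A^T *m Z *m A) *m v) =
  dot v (Q *m v) + dot (A *m v) (Z *m (A *m v)).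
Proof. by rewrite mulmxDl dotDr -!mulmxA -dot_mull. Qed.

Lemma pd_riccati_qf Q W A X v : dot v (pd_riccati Q W A X *m v) =
  dot v (Q *m v) + dot (A *m v) (invmx (invmx X + W) *m (A *m v)).
Proof. exact: sum_congr_qf. Qed.

Lemma pd_inv_add X W : pdmx X -> pdmx W -> pdmx (invmx X + W).
Proof. by move=> /pd_inv pX /pd_psd; apply: pd_addl. Qed.

Lemma pd_riccati_pd Q W A X :
  pdmx Q -> pdmx W -> pdmx X -> pdmx (pd_riccati Q W A X).
Proof.
move=> pQ pW pX; apply: pd_addl => //; apply: psd_congr.
by apply/pd_psd/pd_inv/pd_inv_add.
Qed.

(** X is inverted twice, and each inversion reverses the order. *)
Lemma pd_riccati_mono Q W A X P : pdmx W -> pdmx P -> pdmx X ->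
  qle P X -> qle (pd_riccati Q W A P) (pd_riccati Q W A X).
Proof.
move=> pW pP pX PX v; rewrite !pd_riccati_qf lerD2l.
apply: (qle_inv (pd_inv_add pX pW) (pd_inv_add pP pW)) => y.
by rewrite !mulmxDl !dotDr lerD2r; apply: qle_inv.
Qed.

Lemma pd_riccati_le Q W A X : pdmx W -> pdmx X ->
  qle (pd_riccati Q W A X) (Q + A^T *m invmx W *m A).
Proof.
move=> pW pX v; rewrite pd_riccati_qf mulmxDl dotDr -!mulmxA.
rewrite -dot_mull lerD2l.
apply: (qle_inv pW (pd_inv_add pX pW)) => y.
by rewrite mulmxDl dotDr lerDr psd_ge0 //; apply/pd_psd/pd_inv.
Qed.

(** Apply exp y >= 1 + y at y = p ln mu and y = (p - 1) ln mu with weights 1 - p and p: the linear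
    terms cancel. *)
Lemma weighted_AMGM (p mu : R) : 0 < mu -> 0 <= p <= 1 ->
  1 <= (1 - p) * mu `^ p + p * (mu `^ p / mu).
Proof.
move=> mu0 /andP[p0 p1]; rewrite /powR gt_eqF //.
rewrite -[X in _ / X](lnK mu0) -expRN -expRD.
have := expR_ge1Dx (p * ln mu); have := expR_ge1Dx (p * ln mu - ln mu).
by set a := expR _; set b := expR _; nra.
Qed.

(* A gain A' W^-1 A <= Q / omega caps the increase of the Riccati map along
   the ray mu P, which turns into an exponent 1 / (1 + omega) by weighted
   AM-GM. *)
Lemma pd_riccati_contract Q W A X P (mu om : R) :
  pdmx Q -> pdmx W -> pdmx X -> pdmx P -> 1 <= mu -> 0 < om ->
  (forall v, om * dot v (A^T *m invmx W *m A *m v) <= dot v (Q *m v)) ->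
  (forall v, dot v (X *m v) <= mu * dot v (P *m v)) ->
  forall v, dot v (pd_riccati Q W A X *m v) <=
            mu `^ (1 / (1 + om)) * dot v (pd_riccati Q W A P *m v).
Proof.
move=> pQ pW pX pP mu1 om0 AWA XP v; have mu0 := lt_le_trans ltr01 mu1.
have pmuP : pdmx (mu *: P).
  apply/pdmxP; rewrite linearZ /= pd_sym //; split=> // y y0.
  by rewrite -scalemxAl dotZr mulr_gt0 ?pd_gt0.
have imuP : invmx (mu *: P) = mu^-1 *: invmx P.
  by rewrite invmxZ ?pd_unit.
have XmuP : qle X (mu *: P) by move=> y; rewrite -scalemxAl dotZr.
have pPW := pd_inv_add pP pW.
have pS : pdmx (mu^-1 *: (invmx P + W)).
  apply/pdmxP; rewrite linearZ /= (pd_sym pPW); split=> // y y0.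
  by rewrite -scalemxAl dotZr mulr_gt0 ?pd_gt0 ?invr_gt0.
(* Both X^-1 >= mu^-1 P^-1 and, since mu >= 1, W >= mu^-1 W. *)
have le_mu : qle (invmx (invmx X + W)) (mu *: invmx (invmx P + W)).
  have -> : mu *: invmx (invmx P + W) = invmx (mu^-1 *: (invmx P + W)).
    by rewrite invmxZ ?pd_unit // invrK.
  apply: qle_inv => // [|y]; first exact: pd_inv_add.
  rewrite -scalemxAl dotZr !mulmxDl !dotDr mulrDr lerD //.
    by have := qle_inv pX pmuP XmuP y; rewrite imuP -scalemxAl dotZr.
  by rewrite ler_piMl ?psd_ge0 // ?invf_le1 //; apply: pd_psd.
have le_W : qle (invmx (invmx X + W)) (invmx W).
  apply: qle_inv => // [|y]; first exact: pd_inv_add.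
  by rewrite mulmxDl dotDr lerDr psd_ge0 //; apply/pd_psd/pd_inv.
rewrite !pd_riccati_qf.
have := le_mu (A *m v); rewrite -scalemxAl dotZr.
have := le_W (A *m v); have := AWA v.
rewrite -!mulmxA -dot_mull.
have : 0 <= dot (A *m v) (invmx (invmx X + W) *m (A *m v)).
  by rewrite psd_ge0 //; apply/pd_psd/pd_inv/pd_inv_add.
have : 0 <= dot v (Q *m v) by rewrite psd_ge0 //; apply: pd_psd.
set q := dot v (Q *m v); set yX := dot _ (invmx (invmx X + W) *m _).
set yP := dot _ (invmx (invmx P + W) *m _); set yW := dot _ (invmx W *m _).
set p := 1 / (1 + om) => q0 yX0 yW_q yX_W yX_P.
have om1 : 0 < 1 + om by rewrite addr_gt0.
have p01 : 0 <= p <= 1.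
  by rewrite /p divr_ge0 ?(ltW om1) //= ler_pdivrMr // mul1r lerDl ltW.
have := weighted_AMGM mu0 p01.
have c0 : 0 < mu `^ p by rewrite powR_gt0.
set c := mu `^ p in c0 *.
have [p1 pom] : (1 - p) = om * p /\ 0 < p.
  split; last by rewrite divr_gt0.
  by rewrite /p; field; rewrite gt_eqF.
have c1 : 1 <= c.
  by have := @ler_powR _ mu mu1 0 p; rewrite powRr0; apply; case/andP: p01.
rewrite p1 => amgm.
(* The goal is q + yX <= c (q + yP). The share c / mu of yX is covered by c yP; the rest must fit
   into (c - 1) q, where om yX <= q is available. *)
have cyP : c / mu * yX <= c * yP.
  by rewrite -mulrA ler_wpM2l ?(ltW c0) // mulrC ler_pdivrMr // mulrC.
have omyX : om * yX <= q by apply: le_trans yW_q; rewrite ler_pM2l.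
(* As p (1 + om) = 1, this is the weighted AM-GM inequality divided by p. *)
have ratio : (1 - c / mu) <= om * (c - 1).
  by rewrite -(ler_pM2l pom); move: amgm p1; nra.
have : (1 - c / mu) * yX <= (c - 1) * q.
  have : om * (c - 1) * yX <= (c - 1) * q.
    by rewrite mulrAC mulrC ler_wpM2l // subr_ge0.
  by apply: le_trans; rewrite ler_wpM2r.
by move: cyP; rewrite mulrDr !mulrBl; lra.
Qed.

(** Let U = A' W^-1 A and Q e = mu U e with mu minimal, so mu U <= Q. The first matrix is N = Q + Q
    U^-1 Q and the second L = Q + U, whence e'Ne = mu (1 + mu) e'Ue = mu e'Le. The Rayleigh bounds
    of N and L at e give om <= mu. *)
Lemma contraction_rate_bound Q W A :
  (0 < n)%N -> pdmx Q -> pdmx W -> A \in unitmx ->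
  let om := lambda_min (Q + Q *m invmx A *m W *m invmx A^T *m Q) /
            lambda_max (Q + A^T *m invmx W *m A) in
  forall v, om * dot v (A^T *m invmx W *m A *m v) <= dot v (Q *m v).
Proof.
move=> n0 pQ pW uA; set N := Q + _; set L := Q + _ => om.
pose U := A^T *m invmx W *m A; pose V := invmx A *m W *m invmx A^T.
have pU : pdmx U by apply: pd_congr => //; apply: pd_inv.
have pV : pdmx V.
  rewrite /V -trmx_inv -{1}[invmx A]trmxK; apply: pd_congr => //.
  by rewrite unitmx_tr unitmx_inv.
have VU : V *m U = 1%:M.
  rewrite /V /U -!mulmxA (mulKmx (_ : A^T \in unitmx)) ?unitmx_tr //.
  by rewrite (mulKVmx (pd_unit pW)) mulVmx.
have NE : N = Q + Q^T *m V *m Q by rewrite /N /V (pd_sym pQ) !mulmxA.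
have pN : pdmx N.
  by rewrite NE; apply: pd_addl => //; apply: psd_congr; apply: pd_psd.
have pL : pdmx L by apply: pd_addl => //; apply: pd_psd.
have [Nmin _] := lambda_minP n0 (pd_sym pN).
have [Lmax [f f0 Lf]] := lambda_maxP n0 (pd_sym pL).
have lam0 : 0 < lambda_max L.
  have := pd_gt0 pL f0; rewrite Lf.
  by rewrite pmulr_lgt0 // dot_gt0.
have [mu [e e0 [Qe muU]]] := generalized_eigenvalue_min n0 (pd_sym pQ) pU.
suff le_mu : om <= mu.
  move=> v; apply: le_trans (muU v); rewrite ler_wpM2r // psd_ge0 //.
  exact: pd_psd.
have Ue0 := pd_gt0 pU e0.
have mu0 : 0 < mu.
  by have := pd_gt0 pQ e0; rewrite Qe dotZr pmulr_lgt0.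
have Ne : dot e (N *m e) = mu * (1 + mu) * dot e (U *m e).
  have VUe : V *m (U *m e) = e by rewrite mulmxA VU mul1mx.
  rewrite NE mulmxDl dotDr -2!mulmxA -dot_mull Qe -scalemxAr VUe.
  by rewrite !(dotZl, dotZr) (dotC _ e); ring.
have Le : dot e (L *m e) = (1 + mu) * dot e (U *m e).
  by rewrite mulmxDl dotDr Qe dotZr -/U; ring.
rewrite ler_pdivrMr //.
have := Nmin e; have := Lmax e; rewrite Ne Le => Lm Nm.
have ee : 0 < dot e e by rewrite dot_gt0.
rewrite -(ler_pM2r ee); apply: le_trans Nm _.
by rewrite -!mulrA ler_pM2l // mulrA.
Qed.

(** R0 may be indefinite, so invertibility cannot come from positivity; it is transferred from 1 + W
    X with W = B R0^-1 B'. *)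
Lemma woodbury_unit p (R0 : 'M[R]_p) (B : 'M[R]_(n, p)) X :
  R0 \in unitmx -> 1%:M + B *m invmx R0 *m B^T *m X \in unitmx ->
  R0 + B^T *m X *m B \in unitmx.
Proof.
move=> uR uWX; apply: unitmx_ker => v; rewrite mulmxDl => /eqP.
rewrite addr_eq0 => /eqP Rv.
have vE : v = - (invmx R0 *m (B^T *m X *m B *m v)).
  by rewrite -mulmxN -Rv mulKmx.
have Bv : B *m v = 0.
  apply: (unitmx_inj uWX); rewrite mulmxDl mul1mx {1}vE mulmxN -!mulmxA.
  by rewrite addrC subrr.
by rewrite vE -mulmxA Bv !mulmx0 oppr0.
Qed.

Lemma woodbury p (R0 : 'M[R]_p) (B : 'M[R]_(n, p)) X :
  R0 \in unitmx -> 1%:M + B *m invmx R0 *m B^T *m X \in unitmx ->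
  X - X *m B *m invmx (R0 + B^T *m X *m B) *m B^T *m X =
  X *m invmx (1%:M + B *m invmx R0 *m B^T *m X).
Proof.
move=> uR uWX; have uH := woodbury_unit uR uWX.
apply: (can_inj (mulmxK uWX)); rewrite mulmxKV //.
set H := R0 + _ in uH *.
have BH : B^T *m X *m (1%:M + B *m invmx R0 *m B^T *m X) =
    H *m (invmx R0 *m B^T *m X).
  by rewrite mulmxDr mulmx1 mulmxDl !mulmxA mulmxV // mul1mx.
rewrite mulmxBl -[_ *m B^T *m X *m _]mulmxA -[_ *m B^T *m (X *m _)]mulmxA.
rewrite (mulmxA B^T) BH.
rewrite -(mulmxA _ (invmx H)) mulKmx //.
by rewrite mulmxDr mulmx1 !mulmxA addrK.
Qed.

(** Solving the stationarity equation for v through R0 alone leaves X xp on the right and turns the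
    state equation into A' x = (1 + W X) xp. This determines xp, which is then substituted into the
    costate. *)
Lemma eliminate_input p q (A X : 'M[R]_n) (B : 'M[R]_(n, p)) (C : 'M[R]_(q, n))
    (D : 'M[R]_(q, p)) (R0 : 'M[R]_p) (x : 'cV[R]_n) (v : 'cV[R]_p) :
  R0^T = R0 -> R0 \in unitmx ->
  let W := B *m invmx R0 *m B^T in
  let A' := A - B *m invmx R0 *m D^T *m C in
  let Q' := C^T *m C - C^T *m D *m invmx R0 *m D^T *m C in
  let xp := A *m x + B *m v in
  1%:M + W *m X \in unitmx ->
  D^T *m (C *m x) + R0 *m v + B^T *m (X *m xp) = 0 ->
  C^T *m (C *m x + D *m v) + A^T *m (X *m xp) =
  (Q' + A'^T *m X *m invmx (1%:M + W *m X) *m A') *m x.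
Proof.
move=> sR uR W A' Q' xp uWX.
rewrite addrAC => /eqP; rewrite addr_eq0 => /eqP Ev.
have vE : v = - (invmx R0 *m (D^T *m (C *m x) + B^T *m (X *m xp))).
  by rewrite Ev mulmxN opprK mulKmx.
have xpE : A' *m x = xp + W *m (X *m xp).
  have -> : A' *m x = xp - B *m v - B *m invmx R0 *m D^T *m C *m x.
    by rewrite mulmxBl /xp addrK.
  by rewrite vE /W !mulmxN opprK !mulmxDr !mulmxA addrA addrAC addrK.
have {}xpE : invmx (1%:M + W *m X) *m (A' *m x) = xp.
  by rewrite xpE mulmxA -{1}[xp]mul1mx -mulmxDl mulKmx.
rewrite mulmxDl -[_ *m A' *m x]mulmxA -[_ *m _ *m (A' *m x)]mulmxA xpE -mulmxA.
rewrite /Q' /A' linearB /= 2!mulmxBl !trmx_mul trmxK (symmx_inv sR) {1}vE.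
clearbody xp; rewrite mulmxN mulmxDr mulmxN !mulmxDr opprD !mulmxA.
by rewrite -!addrA; congr (_ + (_ + _)); rewrite addrC.
Qed.

Lemma unit_add1_mul W X : pdmx W -> psdmx X -> 1%:M + W *m X \in unitmx.
Proof.
move=> pW pX; apply: unitmx_ker => v; rewrite mulmxDl mul1mx -mulmxA => vW.
suff Xv : X *m v = 0 by move: vW; rewrite Xv mulmx0 addr0.
apply/eqP/negPn/negP => /(pd_gt0 pW); have := psd_ge0 v pX.
have vE : v = - (W *m (X *m v)) by apply/eqP; rewrite -addr_eq0 vW.
by rewrite {1}vE dotNl dotC; lra.
Qed.

Lemma invmx_add_inv W X : pdmx W -> pdmx X ->
  invmx (invmx X + W) = X *m invmx (1%:M + W *m X).
Proof.
move=> pW pX; have uWX := unit_add1_mul pW (pd_psd pX).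
have pXW := pd_inv_add pX pW.
apply: (can_inj (mulKmx (pd_unit pXW))); rewrite mulmxV ?pd_unit // mulmxA.
by rewrite mulmxDl mulVmx ?pd_unit // mulmxV.
Qed.

(** For v in the range of A and y = (1 + W X)^-1 v, the form is y'Xy + (Xy)'W(Xy). X may be
    singular, as is needed before the P_t are known to be definite. *)
Lemma psd_congr_invmx_add1 W X A : pdmx W -> psdmx X ->
  forall v, 0 <= dot v (A^T *m X *m invmx (1%:M + W *m X) *m A *m v).
Proof.
move=> pW pX v; have uWX := unit_add1_mul pW pX.
rewrite -3!mulmxA -dot_mull; move: (A *m v) => {}v.
set y := invmx (1%:M + W *m X) *m v.
have vE : v = y + W *m (X *m y).
  by rewrite mulmxA -{1}[y]mul1mx -mulmxDl mulKVmx.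
rewrite -/y vE dotDl addr_ge0 ?psd_ge0 //.
by rewrite dotC psd_ge0 //; apply: pd_psd.
Qed.

End riccati_map.

(** * Stationary trajectories of the lifted game *)

Section game_riccati.
Variables (R : realType) (n m : nat) (S : ltv_system R n m) (gamma : R).
Implicit Types (t : nat) (P : 'M[R]_n).

(** The matrix is indefinite, but testing the two rows of a kernel equation with u and w and
    combining them gives u'Ru + (Bu)'P(Bu) + w'(gamma^2 - P)w = 0, a sum of nonnegative terms. *)
Lemma ricM_unit t P : pdmx (sysR S t) -> psdmx P ->
  pdmx ((gamma ^+ 2)%:M - P) -> ricM S gamma t P \in unitmx.
Proof.
move=> pR pP pgP; apply: unitmx_ker => v; rewrite -[v]vsubmxK.
set u := usubmx v; set w := dsubmx v.
rewrite /ricM mul_block_col -[in RHS](@col_mx0 _ m n 1) => /eq_col_mx[Eu Ew].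
have {Eu} : dot u (sysR S t *m u) + dot (sysB S t *m u) (P *m (sysB S t *m u)) +
            dot (sysB S t *m u) (P *m w) = 0.
  move/(congr1 (dot u)): Eu.
  by rewrite dot0r mulmxDl -!mulmxA !dotDr -!dot_mull.
have {Ew} : dot (sysB S t *m u) (P *m w) = dot w (((gamma ^+ 2)%:M - P) *m w).
  move/(congr1 (dot w)): Ew; rewrite dot0r -mulmxA dotDr (dot_sym w _ pP.1).
  by rewrite !mulmxBl !dotDr !dotNr; lra.
have := psd_ge0 u (pd_psd pR); have := psd_ge0 (sysB S t *m u) pP.
have := psd_ge0 w (pd_psd pgP) => w_ge0 Bu_ge0 u_ge0 Ew Eu.
have -> : u = 0.
  by apply/eqP/negPn/negP => /(pd_gt0 pR); lra.
have -> : w = 0 by apply/eqP/negPn/negP => /(pd_gt0 pgP); lra.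
by rewrite col_mx0.
Qed.

(* The stationary inputs of the one-step game, with costate P x_{t+1}. *)
Lemma riccati_stationary t P (x : 'cV[R]_n) :
  pdmx (sysR S t) -> psdmx P -> pdmx ((gamma ^+ 2)%:M - P) ->
  exists u w, let y := P *m (sysA S t *m x + sysB S t *m u + w) in
    [/\ riccati S gamma t P *m x = sysQ S t *m x + (sysA S t)^T *m y,
        sysR S t *m u = - ((sysB S t)^T *m y) & gamma ^+ 2 *: w = y].
Proof.
move=> pR pP pgP; have uM := ricM_unit pR pP pgP.
pose v := - (invmx (ricM S gamma t P) *m (ricL S t P *m x)).
have [u [w vE]] : exists u w, v = col_mx u w.
  by exists (usubmx v), (dsubmx v); rewrite vsubmxK.
have Ev : ricM S gamma t P *m v = - (ricL S t P *m x).
  by rewrite mulmxN mulKVmx.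
have RE : riccati S gamma t P *m x = sysQ S t *m x +
    (sysA S t)^T *m P *m sysA S t *m x + (ricL S t P)^T *m v.
  by rewrite mulmxN /riccati mulmxBl mulmxDl !mulmxA.
have LE : ricL S t P = col_mx ((sysB S t)^T *m P *m sysA S t) (P *m sysA S t).
  by rewrite /ricL tr_row_mx trmx1 !mul_col_mx mul1mx.
rewrite LE vE tr_col_mx mul_row_col !trmx_mul trmxK pP.1 in RE.
move: Ev; rewrite LE vE mul_block_col mul_col_mx opp_col_mx.
move=> /eq_col_mx[Eu Ew]; exists u, w => y; split.
- by rewrite RE /y !mulmxDr !mulmxA !addrA.
- apply/eqP; rewrite -addr_eq0 /y !mulmxDr !mulmxA; apply/eqP.
  move/eqP: Eu; rewrite -subr_eq0 opprK mulmxDl => /eqP <-.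
  by rewrite -!addrA; congr (_ + _); rewrite addrC -!addrA.
- apply/esym/eqP; rewrite -subr_eq0 /y !mulmxDr !mulmxA; apply/eqP.
  move/eqP: Ew; rewrite -subr_eq0 opprK mulmxBl mul_scalar_mx => /eqP <-.
  by rewrite -!addrA addrC -!addrA.
Qed.

End game_riccati.

(** * The Riccati solution over [d] steps *)

Section lifted_riccati_solution.
Variables (R : realType) (n m : nat) (S : ltv_system R n m) (gamma : R).
Variables (d k t : nat).
Hypothesis Qpsd : forall s, psdmx (sysQ S s).
Hypothesis Rpd : forall s, pdmx (sysR S s).

Local Notation A := (lift_A S d k t).
Local Notation B := (tilde_B S d k t).
Local Notation C := (lift_C S d k t).
Local Notation DE := (lift_DE S d k t).
Local Notation tR := (tilde_R S gamma d k t).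
Local Notation tQ := (tilde_Q S gamma d k t).
Local Notation tA := (tilde_A S gamma d k t).
Local Notation tW := (tilde_W S gamma d k t).
Local Notation s := (t + d * k)%N.
Local Notation "'trj'" := (traj S d k t).

Lemma sym_lift_R : (lift_R S d k t)^T = lift_R S d k t.
Proof.
rewrite /lift_R /blkdiag tr_mxblock; apply/eq_mxblock => i j.
by rewrite eq_sym; case: eqP => [->|_]; rewrite ?trmx0 // pd_sym.
Qed.

Lemma sym_tilde_R : tR^T = tR.
Proof.
rewrite /tilde_R tr_block_mx !(linearD, linearN) /= !trmx_mul !trmxK sym_lift_R.
by rewrite tr_scalar_mx.
Qed.

Lemma lift_output_dot x u w x' u' w' :
  dot (C *m x + DE *m col_mx (stk d u) (stk d w))
      (C *m x' + DE *m col_mx (stk d u') (stk d w')) =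
  \sum_(i < d) dot (trj x u w i) (sysQ S (s + i) *m trj x' u' w' i).
Proof.
by rewrite !lift_output dot_stk; apply: eq_bigr => i _; rewrite dot_sqrtmx.
Qed.

Section solution.
Variable P : nat -> 'M[R]_n.
Hypothesis Ppsd : forall s, psdmx (P s).
Hypothesis Pgamma : forall s, pdmx ((gamma ^+ 2)%:M - P s.+1).
Hypothesis Pric : forall s, P s = riccati S gamma s (P s.+1).

(** The stationarity conditions cancel the costate terms of B u' and w' against the input cost.
    Since x', u', w' are arbitrary, the identity telescopes along any comparison trajectory. *)
Lemma riccati_stationary_dot r x : exists u w, forall x' u' w',
  dot (P r *m x) x' =
    dot x (sysQ S r *m x') + (dot u (sysR S r *m u') - gamma ^+ 2 * dot w w') +
    dot (P r.+1 *m (sysA S r *m x + sysB S r *m u + w))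
        (sysA S r *m x' + sysB S r *m u' + w').
Proof.
have [u [w [Px Ru gw]]] :=
  riccati_stationary x (Rpd r) (Ppsd r.+1) (Pgamma r).
exists u, w => x' u' w'; rewrite Pric Px dotDl (dot_mull (sysQ S r)) (Qpsd r).1.
rewrite (dot_mulr (sysR S r)) (pd_sym (Rpd r)) Ru dotNl -dotZl gw.
by rewrite !dotDr !dot_mull !trmxK; lra.
Qed.

Lemma lifted_stationary_sum x : exists u w, forall x' u' w',
  dot (P s *m x) x' =
    \sum_(i < d) (dot (trj x u w i) (sysQ S (s + i) *m trj x' u' w' i) +
      (dot (u i) (sysR S (s + i) *m u' i) - gamma ^+ 2 * dot (w i) (w' i))) +
    dot (P (s + d) *m trj x u w d) (trj x' u' w' d).
Proof.
have /choice[U /(_ _)/cid-/all_sig[W UW]] (rx : nat * 'cV[R]_n) :=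
  riccati_stationary_dot rx.1 rx.2.
(* The stationary inputs are feedbacks [U], [W] of time and state, so the closed-loop states come
   first and the inputs are read off from them. *)
pose xi := fix xi i := if i is j.+1 then sysA S (s + j) *m xi j +
  sysB S (s + j) *m U (s + j, xi j)%N + W (s + j, xi j)%N else x.
pose u i := U (s + i, xi i)%N; pose w i := W (s + i, xi i)%N.
have trjE i : trj x u w i = xi i by elim: i => //= i ->.
(* The horizon is generalised to N because d also occurs in the starting time s. *)
exists u, w => x' u' w'; suff H N : dot (P s *m x) x' =
    \sum_(i < N) (dot (trj x u w i) (sysQ S (s + i) *m trj x' u' w' i) +
      (dot (u i) (sysR S (s + i) *m u' i) - gamma ^+ 2 * dot (w i) (w' i))) +
    dot (P (s + N) *m trj x u w N) (trj x' u' w' N) by apply: H.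
elim: N => [|N IHN]; first by rewrite big_ord0 add0r addn0.
rewrite big_ord_recr /= IHN -addrA; congr (_ + _).
by rewrite trjE (UW (s + N, xi N)%N _ (u' N) (w' N)) /= addnS.
Qed.

(** In the summed identity x' and v' vary independently: the coefficient of x' is the costate
    equation, that of v' the stationarity equation. *)
Lemma lifted_stationary x : exists v : 'cV[R]_(stack d m + stack d n),
  P s *m x = C^T *m (C *m x + DE *m v) + A^T *m (P (s + d) *m (A *m x + B *m v))
  /\ DE^T *m (C *m x) + tR *m v + B^T *m (P (s + d) *m (A *m x + B *m v)) = 0.
Proof.
have [u [w E]] := lifted_stationary_sum x.
exists (col_mx (stk d u) (stk d w)); set v := col_mx _ _.
have {}E x' v' : dot (P s *m x) x' =
    dot (C *m x + DE *m v) (C *m x') + dot (C *m x) (DE *m v') +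
    dot v (tR *m v') + dot (P (s + d) *m (A *m x + B *m v)) (A *m x' + B *m v').
  have [u' [w' ->]] := lift_input_exists v'.
  rewrite (E x' u' w') big_split /= -lift_output_dot -!lift_state tilde_R_form.
  by rewrite !dotDr !dotDl; lra.
split; apply: dot_injr => y.
  rewrite (E y 0) !mulmx0 !dot0r !addr0.
  by rewrite [RHS]dotDl !dot_mulr.
have := E 0 y; rewrite !mulmx0 !dot0r !add0r dot0l => E0.
by rewrite [RHS]E0 !dotDl !dot_mulr sym_tilde_R.
Qed.

Hypotheses (tRu : tR \in unitmx) (tWpd : pdmx tW).

Lemma riccati_solution_lifted :
  P s = tQ + tA^T *m P (s + d) *m invmx (1%:M + tW *m P (s + d)) *m tA.
Proof.
apply/mulmx_eqP => x; have [v [Px Ev]] := lifted_stationary x.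
rewrite Px; apply: eliminate_input Ev => //; first exact: sym_tilde_R.
exact: unit_add1_mul.
Qed.

End solution.

Lemma lifted_riccatiE X : tR \in unitmx -> pdmx tW -> psdmx X ->
  lifted_riccati S gamma d k t X =
  tQ + tA^T *m X *m invmx (1%:M + tW *m X) *m tA.
Proof.
move=> uR pW pX; rewrite /lifted_riccati woodbury //.
  by rewrite -/tW !mulmxA.
exact: unit_add1_mul.
Qed.

Lemma lifted_riccati_pdE X : tR \in unitmx -> pdmx tW -> pdmx X ->
  lifted_riccati S gamma d k t X = pd_riccati tQ tW tA X.
Proof.
move=> uR pW pX; rewrite lifted_riccatiE //; last exact: pd_psd.
by rewrite /pd_riccati invmx_add_inv // !mulmxA.
Qed.

(* A kernel vector of tA yields a stationary trajectory ending at 0; backwards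
   in time its inputs vanish, being stationary against impulses, and the state
   vanishes because the A's are invertible. *)
Lemma tilde_A_unit : gamma != 0 -> (forall r, sysA S r \in unitmx) ->
  tR \in unitmx -> tA \in unitmx.
Proof.
move=> g0 Au uR; apply: unitmx_ker => x tAx.
pose v := - (invmx tR *m (DE^T *m (C *m x))).
have xd : A *m x + B *m v = 0.
  by rewrite -tAx /tilde_A mulmxBl mulmxN !mulmxA.
have Rv : tR *m v = - (DE^T *m (C *m x)) by rewrite mulmxN mulKVmx.
have [u [w vE]] := lift_input_exists v.
rewrite vE lift_state in xd.
have stat u' w' :
    \sum_(i < d) dot (trj x u w i) (sysQ S (s + i) *m trj 0 u' w' i) +
    \sum_(i < d) (dot (u i) (sysR S (s + i) *m u' i) -
                   gamma ^+ 2 * dot (w i) (w' i)) = 0.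
  have /= := tilde_R_form S d k t gamma u w u' w'.
  rewrite -vE (dot_sym _ _ sym_tilde_R) Rv dotNr -dot_mull => E.
  rewrite -lift_output_dot mulmx0 add0r -vE dotDl (dotC (C *m x)).
  by lra.
have back i : (i <= d)%N -> trj x u w (d - i) = 0 /\
    forall j, (d - i <= j < d)%N -> trj x u w j = 0.
  elim: i => [|i IHi] id.
    by rewrite subn0; split=> // j /andP[/leq_ltn_trans h /h]; rewrite ltnn.
  have [x0 xj] := IHi (ltnW id); set j := (d - i.+1)%N.
  have jS : j.+1 = (d - i)%N by rewrite /j subnSK.
  have jd : (j < d)%N by rewrite jS leq_subr.
  (* An impulse at time j leaves the varied state 0 up to j, and the given state is already 0 after
     j; so all state terms vanish and only the input cost at j remains. *)
  have imp u' w' : (forall r, (r != j) -> u' r = 0) ->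
      (forall r, (r != j) -> w' r = 0) ->
      dot (u j) (sysR S (s + j) *m u' j) - gamma ^+ 2 * dot (w j) (w' j) = 0.
    move=> u'0 w'0; have trj0 r : (r <= j)%N -> trj 0 u' w' r = 0.
      elim: r => // r IHr rj /=.
      by rewrite IHr ?(ltnW rj) // u'0 ?w'0 ?ltn_eqF // !mulmx0 !addr0.
    have := stat u' w'; rewrite big1 ?add0r => [|r _]; last first.
      have [rj|jr] := leqP r j; first by rewrite trj0 // mulmx0 dot0r.
      by rewrite xj ?dot0l // -jS jr ltn_ord.
    rewrite (bigD1 (Ordinal jd)) //= big1 ?addr0 // => r rj.
    have {}rj : nat_of_ord r != j by [].
    by rewrite u'0 ?w'0 // mulmx0 !dot0r mulr0 subrr.
  have uj : u j = 0.
    apply/eqP/negPn/negP => /(pd_gt0 (Rpd (s + j))).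
    have := imp (fun r => if r == j then u j else 0) (fun=> 0).
    rewrite eqxx dot0r mulr0 subr0 => -> //; first by rewrite ltxx.
    by move=> r /negPf ->.
  have wj : w j = 0.
    have := imp (fun=> 0) (fun r => if r == j then w j else 0).
    rewrite eqxx mulmx0 dot0r sub0r => /(_ (fun _ _ => erefl)) H.
    apply/eqP; rewrite -dot_eq0; apply/eqP.
    have /eqP := H (fun r rj => ifN_eq _ _ rj).
    by rewrite oppr_eq0 mulf_eq0 expf_eq0 (negPf g0) andbF => /eqP.
  have trj_j : trj x u w j = 0.
    apply: (unitmx_inj (Au (s + j)%N)).
    by move: x0; rewrite -jS /= uj wj mulmx0 !addr0.
  split=> // r /andP[]; rewrite leq_eqVlt => /predU1P[<- //|jr rd].
  by apply: xj; rewrite -jS jr.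
by have [] := back d (leqnn d); rewrite subnn.
Qed.

End lifted_riccati_solution.

(** * Time shift: bounds on window 0 at every base time reach all windows *)

Section time_shift.
Variables (R : realType) (n m : nat) (S : ltv_system R n m) (gamma : R).
Variables (d k t : nat).

Lemma lift_Lambda_shift : lift_Lambda S d 0 (t + d * k) = lift_Lambda S d k t.
Proof. by rewrite /lift_Lambda /blkdiag muln0 addn0. Qed.

Lemma lift_Xi_shift : lift_Xi S d 0 (t + d * k) = lift_Xi S d k t.
Proof. by rewrite /lift_Xi muln0 addn0. Qed.

Lemma lift_Gamma_shift : lift_Gamma S d 0 (t + d * k) = lift_Gamma S d k t.
Proof. by rewrite /lift_Gamma muln0 addn0. Qed.

Lemma lift_R_shift : lift_R S d 0 (t + d * k) = lift_R S d k t.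
Proof. by rewrite /lift_R muln0 addn0. Qed.

Lemma tilde_B_shift : tilde_B S d 0 (t + d * k) = tilde_B S d k t.
Proof.
by rewrite /tilde_B /lift_B /lift_F lift_Lambda_shift lift_Xi_shift.
Qed.

Lemma lift_DE_shift : lift_DE S d 0 (t + d * k) = lift_DE S d k t.
Proof.
by rewrite /lift_DE /lift_D /lift_E lift_Lambda_shift lift_Xi_shift
  lift_Gamma_shift.
Qed.

Lemma tilde_R_shift : tilde_R S gamma d 0 (t + d * k) = tilde_R S gamma d k t.
Proof.
by rewrite /tilde_R /lift_D /lift_E lift_Lambda_shift lift_Xi_shift
  lift_Gamma_shift lift_R_shift.
Qed.

Lemma lift_C_shift : lift_C S d 0 (t + d * k) = lift_C S d k t.
Proof. by rewrite /lift_C lift_Lambda_shift lift_Gamma_shift. Qed.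

Lemma tilde_Q_shift : tilde_Q S gamma d 0 (t + d * k) = tilde_Q S gamma d k t.
Proof. by rewrite /tilde_Q lift_C_shift lift_DE_shift tilde_R_shift. Qed.

Lemma tilde_A_shift : tilde_A S gamma d 0 (t + d * k) = tilde_A S gamma d k t.
Proof.
by rewrite /tilde_A /lift_A lift_Lambda_shift lift_C_shift lift_DE_shift
  tilde_R_shift tilde_B_shift.
Qed.

Lemma tilde_W_shift : tilde_W S gamma d 0 (t + d * k) = tilde_W S gamma d k t.
Proof. by rewrite /tilde_W tilde_R_shift tilde_B_shift. Qed.

Lemma tilde_X_shift : tilde_X S gamma d 0 (t + d * k) = tilde_X S gamma d k t.
Proof. by rewrite /tilde_X tilde_Q_shift tilde_A_shift tilde_W_shift. Qed.

End time_shift.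

(** * Dissipation under the feedback gain *)

Section dissipation.
Variable R : realType.

(** With y = X (f + w), this adds the Fenchel inequality for X^-1 - a^-2 at (y, f) to |y / a - a
    w|^2 >= 0. *)
Lemma sup_disturbance n (X : 'M[R]_n) (a : R) (f w : 'cV[R]_n) :
  a != 0 -> pdmx X -> pdmx (invmx X - (a ^- 2)%:M) ->
  dot (f + w) (X *m (f + w)) <=
  dot f (invmx (invmx X - (a ^- 2)%:M) *m f) + a ^+ 2 * dot w w.
Proof.
move=> a0 pX pN; set y := X *m (f + w).
have yE : invmx X *m y = f + w by rewrite mulKmx ?pd_unit.
have := pd_fenchel y f pN; have := dot_ge0 (a^-1 *: y - a *: w).
rewrite mulmxBl mul_scalar_mx yE.
rewrite !(dotDl, dotDr, dotNl, dotNr, dotZl, dotZr) (dotC w y) (dotC f y).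
rewrite !mulrA (mulrC a) mulVf // -!expr2 exprVn.
by lra.
Qed.

Variables (n m : nat) (S : ltv_system R n m).

Lemma gain_minimizes (a : R) t (X : 'M[R]_n) (x : 'cV[R]_n) u' :
  pdmx (sysR S t) -> pdmx (invmx X - (a ^- 2)%:M) ->
  let Z := invmx (invmx X - (a ^- 2)%:M) in
  let f u := sysA S t *m x + sysB S t *m u in
  let u := - gain S a t X *m x in
  is_true (dot u (sysR S t *m u) + dot (f u) (Z *m f u) <=
           dot u' (sysR S t *m u') + dot (f u') (Z *m f u')).
Proof.
move=> pR pN Z f u; have pZ : pdmx Z by apply: pd_inv.
have pG : pdmx (gain_nabla S a t X).
  by apply: pd_addl => //; apply: psd_congr; apply: pd_psd.
have uE : gain_nabla S a t X *m u = - ((sysB S t)^T *m Z *m sysA S t *m x).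
  rewrite /u mulNmx mulmxN /gain -/Z !mulmxA mulmxV ?pd_unit //.
  by rewrite mul1mx.
clearbody u; have stat : sysR S t *m u + (sysB S t)^T *m (Z *m f u) = 0.
  rewrite /f mulmxDr mulmxDr addrCA !mulmxA -mulmxDl -/(gain_nabla S a t X) uE.
  by rewrite subrr.
have := psd_ge0 (u' - u) (pd_psd pR).
have := psd_ge0 (sysB S t *m (u' - u)) (pd_psd pZ).
have := congr1 (dot (u' - u)) stat; rewrite dot0r dotDr -dot_mull.
have -> : f u' = f u + sysB S t *m (u' - u).
  by rewrite /f mulmxBr addrACA subrr addr0.
move: (sysB S t *m (u' - u)) (f u) => b g; rewrite !mulmxDr !mulmxN.
rewrite !(dotDl, dotDr, dotNl, dotNr) (dot_sym b g (pd_sym pZ)).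
by rewrite (dot_sym u u' (pd_sym pR)); lra.
Qed.

(** Three comparisons: the worst disturbance replaces X by (X^-1 - a^-2)^-1; for that weight the
    gain does at least as well as the stationary input u' of the P-game; and the weight is at most
    (P^-1 - gamma^-2)^-1, for which u' costs exactly the Riccati value. *)
Lemma dissipation_inequality (gamma a : R) t (X P : 'M[R]_n) (x w : 'cV[R]_n) :
  gamma != 0 -> a != 0 ->
  pdmx (sysR S t) -> pdmx P -> pdmx ((gamma ^+ 2)%:M - P) -> pdmx X ->
  pdmx (invmx P - (gamma ^- 2)%:M) -> pdmx (invmx X - (a ^- 2)%:M) ->
  qle (invmx P - (gamma ^- 2)%:M) (invmx X - (a ^- 2)%:M) ->
  let u := - gain S a t X *m x in
  let xp := sysA S t *m x + sysB S t *m u + w in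
  is_true (dot x (sysQ S t *m x) + dot u (sysR S t *m u) + dot xp (X *m xp) <=
           dot x (riccati S gamma t P *m x) + a ^+ 2 * dot w w).
Proof.
move=> g0 a0 pR pP pgP pX pNP pNX NPX u xp.
have [u' [w' []]] := riccati_stationary x pR (pd_psd pP) pgP.
set f' := sysA S t *m x + sysB S t *m u'; set y := P *m (f' + w').
move=> Px Ru gw.
(* Stationarity gives w' = gamma^-2 y, while f' + w' = P^-1 y. *)
have f'E : f' = (invmx P - (gamma ^- 2)%:M) *m y.
  rewrite mulmxBl mul_scalar_mx -gw scalerA mulVf ?expf_neq0 // scale1r.
  by rewrite -[f' in LHS](addrK w') -/y gw /y mulKmx ?pd_unit.
have f'N : dot f' (invmx (invmx P - (gamma ^- 2)%:M) *m f') = dot f' y.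
  by rewrite {2}f'E mulKmx ?pd_unit.
have Pxx : dot x (riccati S gamma t P *m x) =
    dot x (sysQ S t *m x) + dot f' y + dot u' (sysR S t *m u').
  rewrite Px Ru dotNr dotDr -!dot_mull /f' dotDl; lra.
have := sup_disturbance (sysA S t *m x + sysB S t *m u) w a0 pX pNX.
have := gain_minimizes x u' pR pNX; have := qle_inv pNP pNX NPX f'.
by rewrite /= -/u -/xp -/f' f'N Pxx; lra.
Qed.

Lemma inverse_gap n' (X P : 'M[R]_n') (gamma a kappa : R) :
  0 < gamma -> gamma < a -> 0 < kappa -> pdmx X -> pdmx P ->
  (forall v, kappa * dot v v <= dot v (P *m v)) ->
  (forall v, dot v (X *m v) <=
     ((gamma ^- 2 - a ^- 2) * kappa + 1) * dot v (P *m v)) ->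
  qle (invmx P - (gamma ^- 2)%:M) (invmx X - (a ^- 2)%:M).
Proof.
move=> g0 ga k0 pX pP kP XP v; set al := (gamma ^- 2 - a ^- 2) * kappa in XP.
have a0 := lt_trans g0 ga.
have diff0 : 0 < gamma ^- 2 - a ^- 2.
  rewrite subr_gt0 ltf_pV2 ?posrE ?exprn_gt0 //.
  by rewrite ltr_pXn2r // nnegrE ltW.
have al0 : 0 < al by rewrite mulr_gt0.
have al1 : 0 < al + 1 by rewrite addr_gt0.
have pkI := @pd_scalar R n' _ k0.
have : dot v (invmx P *m v) <= kappa^-1 * dot v v.
  rewrite -dotZr -mul_scalar_mx -invmx_scalar.
  by apply: qle_inv => // y; rewrite mul_scalar_mx dotZr.
have paP : pdmx ((al + 1) *: P).
  apply/pdmxP; rewrite linearZ /= pd_sym //; split=> // y y0.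
  by rewrite -scalemxAl dotZr mulr_gt0 ?pd_gt0.
have : (al + 1)^-1 * dot v (invmx P *m v) <= dot v (invmx X *m v).
  rewrite -dotZr scalemxAl -invmxZ; last by rewrite pd_unit.
  by apply: qle_inv => // y; rewrite -scalemxAl dotZr.
rewrite !mulmxBl !mul_scalar_mx !dotDr !dotNr !dotZr.
have := psd_ge0 v (pd_psd (pd_inv pP)).
set p := dot v (invmx P *m v); set q := dot v (invmx X *m v).
set r := dot v v => p0 pq pr.
have {}pr : al * p <= (gamma ^- 2 - a ^- 2) * r.
  by rewrite -mulrA ler_pM2l // -ler_pdivlMl.
suff : p - (al + 1)^-1 * p <= al * p by lra.
rewrite -{1}[p]mul1r -mulrBl ler_wpM2r //.
have -> : 1 - (al + 1)^-1 = al / (al + 1) by field; rewrite gt_eqF.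
by rewrite ler_pdivrMr // mulrDr mulr1 lerDr mulr_ge0 ?ltW.
Qed.

(** Square summability of z is not known beforehand, so partial sums are compared before passing to
    the limit; finiteness of the norm of w excludes oo - oo. *)
Lemma l2norm_sq_le p q (z : nat -> 'cV[R]_p) (w : nat -> 'cV[R]_q) (c : R) :
  0 <= c ->
  (forall N,
     \sum_(t < N) dot (z t) (z t) <= c * \sum_(t < N) dot (w t) (w t)) ->
  ell2 w -> (l2norm_sq z - c%:E * l2norm_sq w <= 0)%E.
Proof.
move=> c0 zw w2.
have w0 t : (0%:E <= (dot (w t) (w t))%:E)%E by rewrite lee_fin dot_ge0.
have wfin : l2norm_sq w \is a fin_num.
  by rewrite ge0_fin_numE //; apply: nneseries_ge0 => t _ _; apply: w0.
have zle : (l2norm_sq z <= c%:E * l2norm_sq w)%E.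
  apply: lime_le.
    by apply: is_cvg_nneseries => t _ _; rewrite lee_fin dot_ge0.
  apply: nearW => N; rewrite sumEFin big_mkord.
  apply: le_trans (_ : (c%:E * (\sum_(t < N) dot (w t) (w t))%:E)%E <= _)%E.
    by rewrite -EFinM lee_fin.
  apply: lee_wpmul2l; first by rewrite lee_fin.
  rewrite -(big_mkord xpredT (fun t => dot (w t) (w t))) -sumEFin.
  exact: nneseries_lim_ge.
by rewrite leeBlDr ?fin_numM // add0e.
Qed.

End dissipation.

(** * Uniform bounds and the preview iteration *)

Section lifted_bounds.
Variables (R : realType) (n m d : nat) (S : ltv_system R n m) (gamma : R).
Hypotheses (n_gt0 : (0 < n)%N) (gamma_gt0 : 0 < gamma).
Hypothesis Qpsd : forall s, psdmx (sysQ S s).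
Hypothesis Rpd : forall s, pdmx (sysR S s).
Hypothesis Aunit : forall s, sysA S s \in unitmx.
Variable P : nat -> 'M[R]_n.
Hypothesis Ppsd : forall s, psdmx (P s).
Hypothesis Pgamma : forall s, pdmx ((gamma ^+ 2)%:M - P s.+1).
Hypothesis Pric : forall s, P s = riccati S gamma s (P s.+1).
Variables cl cu : R.
Hypotheses (cl_gt0 : 0 < cl) (cu_gt0 : 0 < cu).

Local Notation tR := (tilde_R S gamma d 0).
Local Notation tQ := (tilde_Q S gamma d 0).
Local Notation tA := (tilde_A S gamma d 0).
Local Notation tW := (tilde_W S gamma d 0).
Local Notation tX := (tilde_X S gamma d 0).

Hypothesis tR_unit : forall s, tR s \in unitmx.
Hypothesis W_low : forall s, loewner_le cl%:M (tW s).
Hypothesis W_up : forall s, loewner_le (tW s) cu%:M.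
Hypothesis Q_low : forall s, loewner_le cl%:M (tQ s).
Hypothesis Q_up : forall s, loewner_le (tQ s) cu%:M.

Lemma qle_scalar_pd (Z : 'M[R]_n) : loewner_le cl%:M Z -> pdmx Z.
Proof.
move=> clZ; apply: (qle_pd _ (pd_scalar n cl_gt0)).
  exact: loewner_le_sym_scalar clZ.
exact: loewner_leP.
Qed.

Lemma tilde_W_pd s : pdmx (tW s). Proof. exact: qle_scalar_pd. Qed.
Lemma tilde_Q_pd s : pdmx (tQ s). Proof. exact: qle_scalar_pd. Qed.

Lemma tilde_Q_low s v : cl * dot v v <= dot v (tQ s *m v).
Proof. by have := loewner_leP (Q_low s) v; rewrite mul_scalar_mx dotZr. Qed.

Lemma tilde_Q_up s v : dot v (tQ s *m v) <= cu * dot v v.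
Proof. by have := loewner_leP (Q_up s) v; rewrite mul_scalar_mx dotZr. Qed.

Lemma tilde_A_inv s : tA s \in unitmx.
Proof. by apply: tilde_A_unit => //; rewrite gt_eqF. Qed.

Lemma tilde_X_pd s : pdmx (tX s).
Proof.
apply: pd_addl; first exact: tilde_Q_pd.
by apply/psd_congr/pd_psd/pd_inv/tilde_W_pd.
Qed.

Lemma P_formula s : P s = tQ s +
  (tA s)^T *m P (s + d)%N *m invmx (1%:M + tW s *m P (s + d)%N) *m tA s.
Proof.
have := riccati_solution_lifted Qpsd Rpd Ppsd Pgamma Pric
  (tR_unit s) (tilde_W_pd s).
by rewrite muln0 addn0.
Qed.

(** First definiteness of P, obtained from a semidefinite P_{s+d}. *)
Lemma tilde_Q_le_P s : qle (tQ s) (P s).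
Proof.
rewrite P_formula; apply: qle_addr => v.
by apply: psd_congr_invmx_add1 => //; apply: tilde_W_pd.
Qed.

Lemma P_pd s : pdmx (P s).
Proof.
by apply: (qle_pd (Ppsd s).1 (tilde_Q_pd s)); apply: tilde_Q_le_P.
Qed.

Lemma P_lifted s : P s = pd_riccati (tQ s) (tW s) (tA s) (P (s + d)%N).
Proof.
rewrite {1}P_formula /pd_riccati invmx_add_inv ?mulmxA //.
  exact: tilde_W_pd.
exact: P_pd.
Qed.

Lemma P_le_tilde_X s : qle (P s) (tX s).
Proof.
rewrite P_lifted; apply: pd_riccati_le; first exact: tilde_W_pd.
exact: P_pd.
Qed.

Lemma P_bounded : exists2 G : R, 0 < G &
  forall s v, dot v (P s *m v) <= G * dot v v.
Proof.
(* The bound by gamma^2 starts at P_1, so P_0 gets its own constant. *)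
have [C C0 CP] := form_bound (P 0).
exists (C + gamma ^+ 2) => [|s v]; first by rewrite addr_gt0 ?exprn_gt0.
have vv := dot_ge0 v; have g2 := exprn_gt0 2 gamma_gt0.
case: s => [|s].
  by have := CP v; rewrite ler_norml => /andP[_]; nra.
have := psd_ge0 v (pd_psd (Pgamma s)).
by rewrite mulmxBl mul_scalar_mx dotDr dotNr dotZr; nra.
Qed.

(* Solving P_s = tQ + tA' (P_{s+d}^-1 + tW)^-1 tA for tA bounds it without
   estimating the lifted matrices. *)
Lemma tilde_A_bounded : exists2 M : R, 0 < M &
  forall s v, dot (tA s *m v) (tA s *m v) <= M * dot v v.
Proof.
(* K bounds P^-1 + W from above, by P >= Q >= cl and W <= cu. *)
have [G G0 PG] := P_bounded; pose K := cl^-1 + cu.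
have K0 : 0 < K by rewrite addr_gt0 ?invr_gt0.
exists (K * G) => [|s v]; first by rewrite mulr_gt0.
have := PG s v; rewrite P_lifted pd_riccati_qf.
have pPW := pd_inv_add (P_pd (s + d)%N) (tilde_W_pd s).
have PWK : qle (invmx (P (s + d)%N) + tW s) K%:M.
  move=> y; rewrite mulmxDl mul_scalar_mx dotDr dotZr mulrDl lerD //.
    rewrite -dotZr -mul_scalar_mx -invmx_scalar.
    apply: (qle_inv (pd_scalar n cl_gt0) (P_pd _)) => z.
    apply: le_trans (tilde_Q_le_P _ z).
    by rewrite mul_scalar_mx dotZr tilde_Q_low.
  by have := loewner_leP (W_up s) y; rewrite mul_scalar_mx dotZr.
have := qle_inv pPW (pd_scalar n K0) PWK (tA s *m v).
rewrite invmx_scalar mul_scalar_mx dotZr ler_pdivrMl //.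
have := psd_ge0 v (pd_psd (tilde_Q_pd s)); rewrite -mulrA => Qv le1 le2.
by apply: le_trans le1 _; rewrite ler_pM2l //; lra.
Qed.

Lemma tilde_X_bounded : exists2 M : R, 0 < M &
  forall s v, dot v (tX s *m v) <= M * dot v v.
Proof.
have [M M0 AM] := tilde_A_bounded.
exists (cu + cl^-1 * M) => [|s v].
  by rewrite addr_gt0 // mulr_gt0 ?invr_gt0.
rewrite /tilde_X sum_congr_qf mulrDl lerD ?tilde_Q_up //.
apply: le_trans (_ : cl^-1 * dot (tA s *m v) (tA s *m v) <= _); last first.
  by rewrite -mulrA ler_pM2l ?invr_gt0.
rewrite -dotZr -mul_scalar_mx -invmx_scalar.
apply: (qle_inv (pd_scalar n cl_gt0) (tilde_W_pd s)).
exact: loewner_leP.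
Qed.

Lemma lambda_min_tilde_Q s :
  [/\ cl <= lambda_min (tQ s), 0 < lambda_min (tQ s) &
      forall v, lambda_min (tQ s) * dot v v <= dot v (tQ s *m v)].
Proof.
have sQ := pd_sym (tilde_Q_pd s).
have clQ : cl <= lambda_min (tQ s).
  by apply: le_lambda_min => //; apply: tilde_Q_low.
by split=> //; [apply: lt_le_trans clQ|apply: (lambda_minP n_gt0 sQ).1].
Qed.

Lemma lambda_max_tilde_X s :
  0 < lambda_max (tX s) /\
  forall v, dot v (tX s *m v) <= lambda_max (tX s) * dot v v.
Proof.
have [Xmax [e e0 Xe]] := lambda_maxP n_gt0 (pd_sym (tilde_X_pd s)).
split=> //; have := pd_gt0 (tilde_X_pd s) e0; rewrite Xe pmulr_lgt0 //.
by rewrite dot_gt0.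
Qed.

Lemma kappa_low_bounds :
  cl <= kappa_low S gamma d /\
  forall s, kappa_low S gamma d <= lambda_min (tQ s).
Proof.
split=> [|s].
  apply: lb_le_inf; first by exists (lambda_min (tQ 0)); exists 0%N.
  by move=> _ [s _ <-]; have [] := lambda_min_tilde_Q s.
apply: ge_inf; last by exists s.
by exists cl => _ [r _ <-]; have [] := lambda_min_tilde_Q r.
Qed.

Lemma delta_ratio_ubound :
  has_ubound [set delta_ratio S gamma d t | t in [set: nat]].
Proof.
have [M M0 XM] := tilde_X_bounded; exists (M / cl) => _ [s _ <-].
have [clQ Q0 _] := lambda_min_tilde_Q s; have [X0 _] := lambda_max_tilde_X s.
have XleM : lambda_max (tX s) <= M.
  by apply: lambda_max_le => //; apply/pd_sym/tilde_X_pd.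
rewrite /delta_ratio ler_pM // ?(ltW X0) ?invr_ge0 ?(ltW Q0) //.
by rewrite lef_pV2 ?posrE.
Qed.

Local Notation mu0 := (sup [set delta_ratio S gamma d t | t in [set: nat]]).

(** The ratio of extreme eigenvalues compares X~ with Q, and Q <= P. So ln [mu0] bounds the initial
    Thompson distance; [delta_up] is this bound times sqrt n. *)
Lemma tilde_X_le_P s v : dot v (tX s *m v) <= mu0 * dot v (P s *m v).
Proof.
have [clQ Q0 Qmin] := lambda_min_tilde_Q s.
have [X0 Xmax] := lambda_max_tilde_X s.
apply: le_trans (Xmax v) _.
have ratio_mu0 : delta_ratio S gamma d s <= mu0.
  by apply: ub_le_sup; [apply: delta_ratio_ubound|exists s].
have ratio0 : 0 < delta_ratio S gamma d s by rewrite divr_gt0.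
apply: (@le_trans _ _ (delta_ratio S gamma d s * dot v (P s *m v))); last first.
  by rewrite ler_wpM2r ?psd_ge0.
apply: le_trans
  (_ : delta_ratio S gamma d s * (lambda_min (tQ s) * dot v v) <= _).
  by rewrite mulrA divfK ?gt_eqF.
by rewrite ler_pM2l //; apply: le_trans (Qmin v) (tilde_Q_le_P _ _).
Qed.

Lemma mu0_ge1 : 1 <= mu0.
Proof.
have [e e0] : exists e : 'cV[R]_n, e != 0.
  have [_ [e e0 _]] := lambda_minP n_gt0 (pd_sym (tilde_Q_pd 0)).
  by exists e.
have := tilde_X_le_P 0 e; have := P_le_tilde_X 0 e.
by have := pd_gt0 (P_pd 0) e0; nra.
Qed.

(** Each contraction factor is below 1; a uniform lower bound on omega keeps their supremum below 1
    too. *)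
Lemma omega_tilde_low : exists2 om : R, 0 < om &
  forall s, om <= omega_tilde S gamma d s.
Proof.
have [M M0 XM] := tilde_X_bounded; exists (cl / M) => [|s].
  by rewrite divr_gt0.
have [X0 _] := lambda_max_tilde_X s.
have XleM : lambda_max (tX s) <= M.
  by apply: lambda_max_le => //; apply/pd_sym/tilde_X_pd.
rewrite /omega_tilde; set N := _ + _.
have NE : N = tQ s + (invmx (tA s)^T *m tQ s)^T *m tW s *m
                     (invmx (tA s)^T *m tQ s).
  rewrite /N; congr (_ + _).
  by rewrite trmx_mul -trmx_inv trmxK (pd_sym (tilde_Q_pd s)) !mulmxA.
have pW := psd_congr (invmx (tA s)^T *m tQ s) (pd_psd (tilde_W_pd s)).
have clN : cl <= lambda_min N.
  apply: le_lambda_min => // [|v].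
    by apply: pd_sym; rewrite NE; apply: pd_addl pW; apply: tilde_Q_pd.
  apply: le_trans (tilde_Q_low s v) _; rewrite NE; apply: qle_addr => y.
  exact: psd_ge0.
apply: ler_pM => //; first exact: ltW.
  by rewrite invr_ge0 ltW.
by rewrite lef_pV2 ?posrE.
Qed.

Lemma omega_tilde_gt0 s : 0 < omega_tilde S gamma d s.
Proof. by have [om om0 omP] := omega_tilde_low; apply: lt_le_trans (omP s). Qed.

Lemma rho_factor_ubound :
  has_ubound [set rho_factor S gamma d t | t in [set: nat]].
Proof.
exists 1 => _ [s _ <-]; rewrite /rho_factor div1r invf_le1.
  by rewrite lerDl ltW // omega_tilde_gt0.
by rewrite addr_gt0 // omega_tilde_gt0.
Qed.

Lemma rho_factor_le s : rho_factor S gamma d s <= rho_up S gamma d.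
Proof. by apply: ub_le_sup; [apply: rho_factor_ubound|exists s]. Qed.

Lemma rho_up_bounds : 0 < rho_up S gamma d < 1.
Proof.
have [om om0 omP] := omega_tilde_low; apply/andP; split.
  apply: lt_le_trans (rho_factor_le 0).
  by rewrite divr_gt0 // addr_gt0 // omega_tilde_gt0.
apply: (@le_lt_trans _ _ (1 / (1 + om))); last first.
  by rewrite ltr_pdivrMr ?addr_gt0 // mul1r ltrDl.
apply: ge_sup; first by exists (rho_factor S gamma d 0); exists 0%N.
move=> _ [s _ <-]; rewrite /rho_factor !div1r lef_pV2 ?posrE ?addr_gt0 //.
  by rewrite lerD2l.
exact: omega_tilde_gt0.
Qed.

(** N counts the windows still to be applied, the first being k. Windows are peeled off from the
    outside, so k must vary in the induction. *)
Lemma preview_iterate t N k :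
  let Y := foldr (fun j X => lifted_riccati S gamma d j t X)
                 (tilde_X S gamma d (k + N) t) (iota k N) in
  [/\ pdmx Y, qle (P (t + d * k)) Y &
      forall v, dot v (Y *m v) <=
        mu0 `^ (rho_up S gamma d ^+ N) * dot v (P (t + d * k)%N *m v)].
Proof.
elim: N k => [|N IHN] k /=.
  have mu0_ge0 : 0 <= mu0 by apply: le_trans mu0_ge1.
  rewrite addn0 expr0 powRr1 // -(tilde_X_shift S gamma d k t).
  by split; [apply: tilde_X_pd|apply: P_le_tilde_X|apply: tilde_X_le_P].
(* The rewriting keeps the terminal window, as (k + 1) + N = k + (N + 1), and identifies t + d (k +
   1) with s + d. *)
have := IHN k.+1; rewrite addSnnS mulnS [(d + _)%N]addnC addnA.
set Z := foldr _ _ _; set s := (t + d * k)%N; move=> [pZ PZ ZP].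
have -> : lifted_riccati S gamma d k t Z = pd_riccati (tQ s) (tW s) (tA s) Z.
  rewrite tilde_Q_shift tilde_W_shift tilde_A_shift.
  apply: lifted_riccati_pdE => //.
    by rewrite -(tilde_R_shift S gamma d k t).
  by rewrite -(tilde_W_shift S gamma d k t); apply: tilde_W_pd.
have [pW pQ pP] := And3 (tilde_W_pd s) (tilde_Q_pd s) (P_pd (s + d)).
rewrite [P s]P_lifted.
split; [exact: pd_riccati_pd|exact: pd_riccati_mono|move=> v].
have rho01 := rho_up_bounds.
have mu1 := mu0_ge1.
have pow1 : 1 <= mu0 `^ (rho_up S gamma d ^+ N).
  rewrite -[leLHS](powRr0 mu0) ler_powR // exprn_ge0 // ltW //.
  by case/andP: rho01.
have AQ := contraction_rate_bound n_gt0 pQ pW (tilde_A_inv s).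
apply: le_trans
  (pd_riccati_contract pQ pW pZ pP pow1 (omega_tilde_gt0 s) AQ ZP v) _.
rewrite ler_wpM2r //; first by rewrite psd_ge0 //; apply/pd_psd/pd_riccati_pd.
rewrite -powRrM ler_powR // exprSr ler_wpM2l ?rho_factor_le //.
by rewrite exprn_ge0 // ltW //; case/andP: rho01.
Qed.

Lemma mu0_powR_le beta T : 0 < beta -> (0 < T)%N ->
  T_low S gamma beta d < T%:R ->
  mu0 `^ (rho_up S gamma d ^+ T) <= alpha_low S gamma beta d + 1.
Proof.
move=> b0 T0; rewrite /T_low ln_powR.
have [rho0 rho1] := andP rho_up_bounds.
set rho := rho_up S gamma d in rho0 rho1 *.
have mu1 := mu0_ge1; have mu00 : 0 < mu0 := lt_le_trans ltr01 mu1.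
have al0 : 0 < alpha_low S gamma beta d.
  rewrite mulr_gt0 //; last exact: lt_le_trans kappa_low_bounds.1.
  rewrite subr_gt0 ltf_pV2 ?posrE ?exprn_gt0 ?addr_gt0 //.
  by rewrite ltr_pXn2r ?nnegrE ?ltrDl // ltW // addr_gt0.
have lnmu0 : 0 <= ln mu0 by rewrite ln_ge0.
have sqrtn1 : 1 <= Num.sqrt n%:R :> R.
  by rewrite -[leLHS]sqrtr1 ler_wsqrtr // ler1n.
have lnal : 0 < ln (alpha_low S gamma beta d + 1) by rewrite ln_gt0 // ltrDr.
have delta_mu : ln mu0 <= delta_up S gamma d by rewrite /delta_up ler_peMl.
set delta := delta_up S gamma d in delta_mu *.
move=> TT; rewrite -[leRHS]lnK ?posrE ?addr_gt0 //.
rewrite /powR gt_eqF // ler_expR.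
apply: (@le_trans _ _ (rho ^+ T * delta)).
  by rewrite ler_pM2l ?exprn_gt0.
(* If delta = 0 the exponent 1 / delta defaults to 0 and the bound on T carries no information, but
   the goal is then 0 <= ln (alpha + 1). *)
have [->|delta0] := eqVneq delta 0; first by rewrite mulr0 ltW.
have {}delta0 : 0 < delta by rewrite lt0r delta0 (le_trans lnmu0).
rewrite -ler_pdivlMr //; apply: ltW.
rewrite -ltr_ln ?posrE ?exprn_gt0 ?divr_gt0 // lnXn // -mulr_natl.
have lnrho : ln rho < 0 by rewrite ln_lt0 // rho0.
(* Multiplying by ln rho < 0 reverses the inequality, so the lower bound on T becomes an upper bound
   on ln (rho^T). *)
by move: TT; rewrite ltr_ndivrMr // div1r [_^-1 * _]mulrC.
Qed.

Lemma preview_bounds beta T : 0 < beta -> (0 < T)%N ->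
  T_low S gamma beta d < T%:R -> forall t,
  let X := preview_X S gamma d T t in
  [/\ pdmx X, qle (P t) X &
      forall v, dot v (X *m v) <=
        (alpha_low S gamma beta d + 1) * dot v (P t *m v)].
Proof.
move=> b0 T0 TT t X; have := preview_iterate t T 0.
rewrite muln0 addn0 add0n -/X => -[pX PX XP]; split=> // v.
apply: le_trans (XP v) _; rewrite ler_wpM2r ?psd_ge0 //.
exact: mu0_powR_le.
Qed.

End lifted_bounds.

(** A real [sup] or [inf] has a default value when it does not exist; this is why finiteness is
    asserted through [has_ubound]. The bounds on X_{t+1} assert that the gain is taken within its
    domain. *)
Theorem theorem2 (R : realType) (n m d : nat)
    (n_gt0 : (0 < n)%N) (m_gt0 : (0 < m)%N) (d_gt0 : (0 < d)%N)
    (S : ltv_system R n m) (HS : standing_assumptions S d)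
    (gamma : R) (gamma_gt0 : 0 < gamma)
    (cond1 : exists P : nat -> 'M[R]_n,
       [/\ forall t, psdmx (P t),
           exists2 eps : R, 0 < eps &
             forall t, loewner_le (P t.+1 - (gamma ^+ 2)%:M) (- eps%:M)
         & forall t, P t = riccati S gamma t (P t.+1)])
    (cond2 : exists c_low c_up : R,
       [/\ 0 < c_low, 0 < c_up
         & forall t,
           [/\ loewner_le c_low%:M
                 ((tilde_R S gamma d 0 t)^T *m tilde_R S gamma d 0 t) /\
               loewner_le
                 ((tilde_R S gamma d 0 t)^T *m tilde_R S gamma d 0 t) c_up%:M,
               loewner_le c_low%:M
                 (tilde_B S d 0 t *m invmx (tilde_R S gamma d 0 t)
                    *m (tilde_B S d 0 t)^T) /\
               loewner_le
                 (tilde_B S d 0 t *m invmx (tilde_R S gamma d 0 t)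
                    *m (tilde_B S d 0 t)^T) c_up%:M
             & loewner_le c_low%:M (tilde_Q S gamma d 0 t) /\
               loewner_le (tilde_Q S gamma d 0 t) c_up%:M]])
    (beta : R) (beta_gt0 : 0 < beta) :
  [/\ 0 < kappa_low S gamma d,
      has_ubound [set delta_ratio S gamma d t | t in [set: nat]],
      has_ubound [set rho_factor S gamma d t | t in [set: nat]] /\
        rho_up S gamma d < 1
    & forall T : nat, (0 < T)%N -> T_low S gamma beta d < T%:R ->
      (forall t, pdmx (preview_X S gamma d T t.+1) /\
         loewner_lt (preview_X S gamma d T t.+1) ((gamma + beta) ^+ 2)%:M) /\
      (forall (u : nat -> 'cV[R]_m) (w : nat -> 'cV[R]_n),
         (forall t, u t =
            - gain S (gamma + beta) t (preview_X S gamma d T t.+1)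
                *m state S u w t) ->
         ell2 w ->
         (perf_J S (gamma + beta) u w <= 0)%E)].
Proof.
case: HS => Qpsd Rpd _ _ _ _ Aunit _ _ _.
have [P [Ppsd [eps eps0 Peps] Pric]] := cond1.
have [cl [cu [cl0 cu0 cond]]] := cond2.
have Pgamma s : pdmx ((gamma ^+ 2)%:M - P s.+1).
  apply/pdmxP; split=> [|v v0].
    by rewrite linearB /= tr_scalar_mx (Ppsd s.+1).1.
  have := loewner_leP (Peps s) v.
  rewrite mulmxBl mulNmx mulmxBl !mul_scalar_mx !dotDr !dotNr !dotZr.
  by have := mulr_gt0 eps0 (etrans (dot_gt0 v) v0); lra.
have tRu s : tilde_R S gamma d 0 s \in unitmx.
  have [[RR _] _ _] := cond s; apply: unitmx_ker => v Rv; apply/eqP.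
  rewrite -dot_eq0 eq_le dot_ge0 andbT -(pmulr_rle0 _ cl0).
  have := loewner_leP RR v.
  by rewrite -mulmxA Rv mulmx0 dot0r mul_scalar_mx dotZr.
have Wlow s : loewner_le cl%:M (tilde_W S gamma d 0 s) by have [_ []] := cond s.
have Wup s : loewner_le (tilde_W S gamma d 0 s) cu%:M by have [_ []] := cond s.
have Qlow s : loewner_le cl%:M (tilde_Q S gamma d 0 s).
  by have [_ _ []] := cond s.
have Qup s : loewner_le (tilde_Q S gamma d 0 s) cu%:M.
  by have [_ _ []] := cond s.
have Ppd s : pdmx (P s).
  exact: (P_pd Qpsd Rpd Ppsd Pgamma Pric cl0 tRu Wlow Qlow).
have [clk kQ] := kappa_low_bounds n_gt0 cl0 Qlow.
have k0 : 0 < kappa_low S gamma d := lt_le_trans cl0 clk.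
split=> //.
- exact: (delta_ratio_ubound n_gt0 gamma_gt0 Qpsd Rpd Ppsd Pgamma Pric cl0 cu0).
- split; first exact: (rho_factor_ubound n_gt0 gamma_gt0 Qpsd Rpd Ppsd Pgamma
    Pric cl0 cu0).
  have := rho_up_bounds n_gt0 gamma_gt0 Qpsd Rpd Ppsd Pgamma Pric cl0 cu0 tRu
    Wlow Wup Qlow Qup.
  by case/andP.
move=> T T0 TT; pose X t := preview_X S gamma d T t.
have bnd t := preview_bounds n_gt0 gamma_gt0 Qpsd Rpd Aunit Ppsd Pgamma Pric
  cl0 cu0 tRu Wlow Wup Qlow Qup beta_gt0 T0 TT t.
set a := gamma + beta.
have ga : gamma < a by rewrite ltrDl.
have a0 : 0 < a := lt_trans gamma_gt0 ga.
have a2 : 0 < a ^+ 2 by rewrite exprn_gt0.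
have pNP t : pdmx (invmx (P t.+1) - (gamma ^- 2)%:M).
  rewrite -invmx_scalar; apply: pd_inv_lt => //.
  by apply: pd_scalar; rewrite exprn_gt0.
have NPX t : qle (invmx (P t.+1) - (gamma ^- 2)%:M)
                 (invmx (X t.+1) - (a ^- 2)%:M).
  have [pX _ XP] := bnd t.+1.
  apply: (inverse_gap gamma_gt0 ga k0 pX (Ppd _) _ XP) => v.
  have := tilde_Q_le_P Qpsd Rpd Ppsd Pgamma Pric cl0 tRu Wlow t.+1 v.
  apply: le_trans.
  have [_ _] := lambda_min_tilde_Q n_gt0 cl0 Qlow t.+1 => /(_ v).
  by apply: le_trans; rewrite ler_wpM2r ?dot_ge0.
have pX t : pdmx (X t.+1) by have [] := bnd t.+1.
have pNX t : pdmx (invmx (X t.+1) - (a ^- 2)%:M).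
  apply: qle_pd (pNP t) (NPX t).
  by rewrite linearB /= tr_scalar_mx symmx_inv // pd_sym.
split=> [t|u w uE w2].
  split; first exact: pX.
  have := pNX t; rewrite -invmx_scalar => /(pd_inv_lt _ (pd_inv (pX t))).
  by rewrite !invmxK; apply; apply: pd_inv; apply: pd_scalar.
apply: l2norm_sq_le w2; first exact: ltW.
move=> N; set x := state S u w.
(* The storage term x_N' P_N x_N makes the estimate inductive; it starts at 0 because x_0 = 0. *)
suff : \sum_(t < N) dot (perf_output S u w t) (perf_output S u w t) +
    dot (x N) (P N *m x N) <= a ^+ 2 * \sum_(t < N) dot (w t) (w t).
  by apply: le_trans; rewrite lerDl psd_ge0.
elim: N => [|N IHN]; first by rewrite !big_ord0 add0r mulr0 dot0l.
rewrite !big_ord_recr /= dot_col_mx !dot_sqrtmx //; last exact: pd_psd.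
have := dissipation_inequality (x N) (w N) (lt0r_neq0 gamma_gt0) (lt0r_neq0 a0)
  (Rpd N)
  (Ppd N.+1) (Pgamma N) (pX N) (pNP N) (pNX N) (NPX N).
rewrite /= -Pric -uE.
(* One step is dissipative with X_{N+1} as terminal weight; P_{N+1} <= X_{N+1} returns to the
   storage function. *)
have [_ PX _] := bnd N.+1; have := PX (x N.+1); rewrite /= -/(x N) mulrDr.
by move: IHN; rewrite -/x; lra.
Qed.
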